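(* Let $\kappa$ be a regular uncountable cardinal. Every homogeneous $\kappa$-Souslin algebra has an $\infty$-nice subalgebra.
   Context: A $\kappa$-Souslin algebra is a complete Boolean algebra with the $\kappa$-chain condition and the $(\kappa,\infty)$-distributive law; only those possessing a Souslinization are considered. Subalgebras are complete and regular. A Souslinization of $\mathbb{B}$ is a dense subset $T\subseteq\mathbb{B}\setminus\{0\}$ such that $(T,>_{\mathbb{B}})$ is a normal $\kappa$-Souslin tree and every node of limit height is the product of its predecessors. $\mathbb{B}$ is homogeneous if $\mathbb{B}\upharpoonright b\cong\mathbb{B}$ for all $b\ne0$. A tree equivalence relation (t.e.r.) on a $\kappa$-normal tree $T$ of height $\le\kappa$ is an equivalence relation $\equiv$ such that: (i) equivalent nodes have equal height; (ii) if $s<s'$, $t<t'$, $\mathrm{ht}(s)=\mathrm{ht}(t)$, $s'\equiv t'$ then $s\equiv t$; (iii) $T/\!\equiv$ ordered by $a<b$ iff some $s\in a,t\in b$ have $s<t$ is a $\kappa$-normal tree; (iv) if $s\equiv t$ on level $\gamma$, $s'>s$ and no $t'>t$ is equivalent to $s'$, then no $t'\in T_{\gamma+1}$ above $t$ is equivalent to $s'\upharpoonright(\gamma+1)$. It represents the subalgebra $\mathbb{A}$ if the sums $\sum(s/\!\equiv)$ completely generate $\mathbb{A}$. It is $\mu$-nice if (nice:) $s<s'$, $s\equiv t$ imply some $t'>t$ with $t'\equiv s'$, and for all $\alpha<\beta<\mathrm{ht}(T)$, $s\in T_\beta$, $r\equiv s\upharpoonright\alpha$, the set $\{t\in s/\!\equiv:t\upharpoonright\alpha=r\}$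 has at least $\mu$ elements. A subalgebra $\mathbb{A}$ is $\infty$-nice in $\mathbb{B}$ if for a Souslinization $T$ of $\mathbb{B}$ and some (equivalently any) cardinal $1<\mu<\kappa$ there is a club $C\subseteq\kappa$ such that $T\upharpoonright C=\bigcup_{\alpha\in C}T_\alpha$ carries a $\mu$-nice t.e.r. representing $\mathbb{A}$. *)

(* Defs.v *)
From HB Require Import structures.
From mathcomp Require Import all_boot all_order.
From mathcomp Require Import all_classical wochoice.

Set Implicit Arguments.
Unset Strict Implicit.
Unset Printing Implicit Defensive.

Import Order.TTheory.

Local Open Scope classical_set_scope.
Local Open Scope card_scope.

(** A cardinal kappa is represented, as usual, by the well-ordered set of all
    ordinals below it: an order type [K] whose elements are these ordinals.
    [X] has fewer than kappa elements iff [~ ([set: K] #<= X)]. *)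

Section Cardinals.
Context {dK : Order.disp_t} {K : orderType dK}.

Definition below (a : K) : set K := [set b | (b < a)%O].

Definition is_succ (a b : K) : Prop :=
  (a < b)%O /\ forall c, (a < c)%O -> (b <= c)%O.

Definition is_limit (a : K) : Prop :=
  (exists b, (b < a)%O) /\
  forall b, (b < a)%O -> exists c, (b < c)%O /\ (c < a)%O.

Definition is_cardinal (a : K) : Prop :=
  forall b, (b < a)%O -> ~ (below a #<= below b).

Definition unbounded (C : set K) : Prop :=
  forall a, exists2 b, C b & (a <= b)%O.

Definition closed_below (C : set K) : Prop :=
  forall a, is_limit a ->
    (forall b, (b < a)%O -> exists c, [/\ C c, (b <= c)%O & (c < a)%O]) -> C a.

Definition club (C : set K) : Prop := closed_below C /\ unbounded C.

End Cardinals.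

Record regular_uncountable_cardinal dK (K : orderType dK) : Prop := {
  ruc_wo : well_order (<=%O : rel K);
  ruc_cardinal : forall a : K, ~ ([set: K] #<= below a);
  ruc_uncountable : ~ countable [set: K];
  ruc_regular : forall A : set K, unbounded A -> [set: K] #<= A
}.

(** A tree is a set [X] of nodes in an ambient type [V], together with a strict
    order [lt] of which only the restriction to [X] matters. *)

Section Trees.
Context {dK : Order.disp_t} (K : orderType dK).
Context {V : Type} (X : set V) (lt : V -> V -> Prop).

Definition preds (x : V) : set V := [set y | X y /\ lt y x].

Record is_tree : Prop := {
  tree_irr : forall x, X x -> ~ lt x x;
  tree_trans : forall x y z, X x -> X y -> X z -> lt x y -> lt y z -> lt x z;
  tree_wo : forall x, X x -> forall A, A `<=` preds x -> A !=set0 ->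
    exists2 y, A y & forall z, A z -> z = y \/ lt y z
}.

(** The height of [x] is the order type [a] of its set of predecessors. *)
Definition height (x : V) (a : K) : Prop :=
  exists2 f : V -> K, set_bij (preds x) (below a) f &
    forall y z, preds x y -> preds x z -> (lt y z <-> (f y < f z)%O).

Definition level (a : K) : set V := [set x | X x /\ height x a].

Definition imm_succ (s t : V) : Prop :=
  [/\ X t, lt s t & ~ exists z, [/\ X z, lt s z & lt z t]].

(** [r] is the restriction of [s] to level [a]. *)
Definition restr (s : V) (a : K) (r : V) : Prop :=
  level a r /\ (r = s \/ lt r s).

Record knormal : Prop := {
  kn_tree : is_tree;
  kn_height : forall x, X x -> exists a : K, height x a;
  kn_root : exists! r, X r /\ preds r = set0;
  kn_small : forall a : K, ~ ([set: K] #<= level a);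
  kn_split : forall s, X s -> (exists2 t, X t & lt s t) ->
    exists t1 t2, [/\ imm_succ s t1, imm_succ s t2 & t1 <> t2];
  kn_ext : forall (a b : K) s, (a < b)%O -> level a s -> level b !=set0 ->
    exists2 t, level b t & lt s t;
  kn_limit : forall (a : K) s t, is_limit a -> level a s -> level a t ->
    preds s = preds t -> s = t
}.

Definition tree_chain (A : set V) : Prop :=
  A `<=` X /\ forall x y, A x -> A y -> [\/ x = y, lt x y | lt y x].

Definition tree_antichain (A : set V) : Prop :=
  A `<=` X /\ forall x y, A x -> A y -> ~ lt x y.

Record normal_souslin_tree : Prop := {
  st_normal : knormal;
  st_height : forall a : K, level a !=set0;
  st_chain : forall A, tree_chain A -> ~ ([set: K] #<= A);
  st_antichain : forall A, tree_antichain A -> ~ ([set: K] #<= A)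
}.

Definition restrict_levels (C : set K) : set V :=
  [set x | exists2 a, C a & level a x].

End Trees.

(** Tree equivalence relations; [R] matters only on the nodes of [X]. *)

Section TER.
Context {dK : Order.disp_t} (K : orderType dK).
Context {V : Type} (X : set V) (lt : V -> V -> Prop) (R : V -> V -> Prop).

Definition eqclass (s : V) : set V := [set t | X t /\ R s t].

Definition quotient_nodes : set (set V) := eqclass @` X.

Definition quotient_lt (a b : set V) : Prop :=
  exists s t, [/\ a s, b t & lt s t].

Record is_ter : Prop := {
  ter_normal : knormal K X lt;
  ter_refl : forall s, X s -> R s s;
  ter_sym : forall s t, X s -> X t -> R s t -> R t s;
  ter_trans : forall s t u, X s -> X t -> X u -> R s t -> R t u -> R s u;
  ter_level : forall s t (a : K), X t -> R s t -> level X lt a s ->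
    level X lt a t;
  ter_down : forall s s' t t' (a : K), level X lt a s -> level X lt a t ->
    X s' -> X t' -> lt s s' -> lt t t' -> R s' t' -> R s t;
  ter_quotient : knormal K quotient_nodes quotient_lt;
  ter_honest : forall s t s' u (c c' : K), level X lt c s -> level X lt c t ->
    R s t -> X s' -> lt s s' ->
    ~ (exists t', [/\ X t', lt t t' & R s' t']) ->
    is_succ c c' -> restr X lt s' c' u ->
    ~ (exists t', [/\ level X lt c' t', lt t t' & R u t'])
}.

Record nice_ter (M : set K) : Prop := {
  nice_ext : forall s s' t, X s -> X s' -> X t -> lt s s' -> R s t ->
    exists t', [/\ X t', lt t t' & R s' t'];
  nice_card : forall (a b : K) s q r, (a < b)%O -> level X lt b s ->
    restr X lt s a q -> X r -> R r q ->
    M #<= [set t | eqclass s t /\ restr X lt t a r]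
}.

End TER.

Section Algebras.
Context {dK : Order.disp_t} (K : orderType dK).
Context {dB : Order.disp_t} (B : ctbDistrLatticeType dB).

Definition bsum (A : set B) : B := supremum \bot%O A.
Definition bprod (A : set B) : B := infimum \top%O A.

Definition complete_algebra : Prop :=
  forall A : set B, supremums A !=set0 /\ infimums A !=set0.

Definition chain_condition : Prop :=
  forall A : set B, (forall x, A x -> x <> \bot%O) ->
    (forall x y, A x -> A y -> x <> y -> (x `&` y)%O = \bot%O) ->
    ~ ([set: K] #<= A).

(** Products of fewer than kappa sums of arbitrary length distribute. Products
    of kappa many sums are excluded: that law already fails for the levels of a
    Souslinization. *)
Definition distributive_law : Prop :=
  forall (I J : Type) (u : I -> J -> B), ~ ([set: K] #<= [set: I]) ->
    bprod (range (fun i => bsum (range (u i)))) =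
    bsum (range (fun f : I -> J => bprod (range (fun i => u i (f i))))).

Definition above (s t : B) : Prop := (t < s)%O.

Record souslinization (T : set B) : Prop := {
  sz_nonzero : ~ T \bot%O;
  sz_dense : forall b : B, b <> \bot%O -> exists2 t, T t & (t <= b)%O;
  sz_tree : normal_souslin_tree K T above;
  sz_limit : forall t (a : K), is_limit a -> level T above a t ->
    t = bprod (preds T above t)
}.

Record souslin_algebra : Prop := {
  sa_complete : complete_algebra;
  sa_cc : chain_condition;
  sa_distr : distributive_law;
  sa_souslinization : exists T, souslinization T
}.

(** The empty sum and the empty product put 0 and 1 in the subalgebra. *)
Record complete_subalgebra (A : set B) : Prop := {
  csa_compl : forall x, A x -> A (~` x)%O;
  csa_sum : forall S, S `<=` A -> A (bsum S);
  csa_prod : forall S, S `<=` A -> A (bprod S)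
}.

Definition isomorphic_to_relative (b : B) : Prop :=
  exists f : B -> B,
    [/\ set_bij [set: B] [set x | (x <= b)%O] f,
        {morph f : x y / (x `|` y)%O >-> (x `|` y)%O},
        {morph f : x y / (x `&` y)%O >-> (x `&` y)%O} &
        forall x, f (~` x)%O = (b `\` f x)%O].

Definition homogeneous : Prop :=
  forall b : B, b <> \bot%O -> isomorphic_to_relative b.

Definition represents (X : set B) (R : B -> B -> Prop) (A : set B) : Prop :=
  A = smallest complete_subalgebra [set bsum (eqclass X R s) | s in X].

Definition infty_nice (A : set B) : Prop :=
  exists T : set B, souslinization T /\
  exists mu : K, [/\ is_cardinal mu, ~ (below mu #<= [set: unit]) &
  exists C : set K, club C /\
  exists R : B -> B -> Prop,
    [/\ is_ter K (restrict_levels T above C) above R,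
        nice_ter (restrict_levels T above C) above R (below mu) &
        represents (restrict_levels T above C) R A]].

End Algebras.

(* Main.v *)
(** Homogeneity provides an isomorphism [G q : B -> B|q] for every [q <> 0].
    A new Souslinization is built by recursion on the height, together with an
    isomorphism [phi_s : B -> B|s] for every node [s], so that for [s], [t] on a
    common level the isomorphism [phi_t o phi_s^-1 : B|s -> B|t] preserves all
    higher levels, and its restrictions are the isomorphisms between the higher
    nodes.
    - At a successor height the nodes above [s] are the [phi_s q], where [q]
      runs through one fine partition [Q] of unity common to the whole level,
      and [phi_(phi_s q) = phi_s o G q].  Distributivity yields a [Q] such that
      the new level refines a level of the given Souslinization; this makes the
      new tree dense.
    - At a limit height the nodes are the nonzero products of branches.  Two of
      them are tied together by the lower isomorphisms when some [phi_t o
      phi_s^-1] maps one to the other; one isomorphism is chosen freely in each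
      class of this relation and carried to the rest of the class.
    The pieces [Q] of a successor level are cut into two halves, each containing
    at least two pieces: this attaches a bit to every node of successor height.
    Two nodes of equal height are equivalent when they and their predecessors
    carry the same bits.  The isomorphisms preserve the bits, so the equivalence relation
    is nice, and the halves have at least two elements, so it is 2-nice. *)

Require Import Defs.
From mathcomp Require Import all_boot all_order.
From mathcomp Require Import all_classical wochoice.

Set Implicit Arguments.
Unset Strict Implicit.
Unset Printing Implicit Defensive.

Import Order.Theory.

Local Open Scope classical_set_scope.
Local Open Scope card_scope.

(** * Cardinal comparison through explicit injections *)

Lemma card_le_fun T U (A : set T) (B : set U) (f : T -> U) :
  set_fun A B f -> set_inj A f -> A #<= B.
Proof. by move=> ff fi; case: (iffRL injfunPex (ex_intro2 _ _ f ff fi)) => g; exact: inj_card_le. Qed.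

Lemma card_le_funE T U (x0 : U) (A : set T) (B : set U) : A #<= B ->
  exists2 f : T -> U, set_fun A B f & set_inj A f.
Proof.
move/card_leP => -[f].
pose g x := if pselect (A x) is left Ax then set_val (f (SigSub (mem_set Ax))) else x0.
exists g => [x Ax|x y /set_mem Ax /set_mem Ay]; rewrite /g.
  by case: pselect => // {}Ax; apply: set_valP.
case: pselect => // {}Ax; case: pselect => // {}Ay /val_inj.
by move/(inj (mem_set I) (mem_set I)) => -[].
Qed.

(** * Ordinals below kappa: induction, successors, limits, recursion *)

Section Ordinals.
Context {dK : Order.disp_t} {K : orderType dK}.
Hypothesis hK : regular_uncountable_cardinal K.

Lemma ord_min (A : set K) : A !=set0 ->
  exists2 a, A a & forall b, A b -> (a <= b)%O.
Proof.
case=> x Ax; have [|a [[aA amin] _]] := ruc_wo hK (A := mem A).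
  by exists x; apply/mem_set.
by exists a => [|b Ab]; [exact: set_mem|apply: amin; exact: mem_set].
Qed.

Lemma ord_ind (P : K -> Prop) :
  (forall a, (forall b, (b < a)%O -> P b) -> P a) -> forall a, P a.
Proof.
move=> IH a; apply: contrapT => nPa.
have [|b nPb bmin] := ord_min (A := [set c | ~ P c]); first by exists a.
apply: nPb; apply: IH => c cb; apply: contrapT => /bmin.
by rewrite leNgt cb.
Qed.

Lemma ord_wf : well_founded (fun b a : K => (b < a)%O).
Proof. by apply: ord_ind => a IH; constructor. Qed.

(** A greatest element would make a singleton unbounded, and regularity would embed all of [K] into
    it, against uncountability. *)
Lemma ord_gt (a : K) : exists b, (a < b)%O.
Proof.
apply: contrapT => /forallNP amax; apply: (ruc_uncountable hK).
suff Ka : [set: K] #<= [set a] by exact: sub_countable Ka (countable1 _).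
apply: (ruc_regular hK) => b; exists a => //.
by have := amax b; case: ltP.
Qed.

Lemma ord_succ (a : K) : exists b, is_succ a b.
Proof.
have [b ab bmin] := ord_min (A := [set c | (a < c)%O]) (ord_gt a).
by exists b.
Qed.

Lemma succ_lt (a b c : K) : is_succ a b -> (c < b)%O = (c <= a)%O.
Proof.
case=> ab bmin; apply/idP/idP => [cb|/le_lt_trans]; last exact.
by rewrite leNgt; apply/negP => /bmin; rewrite leNgt cb.
Qed.

Lemma succ_inj (a a' b : K) : is_succ a b -> is_succ a' b -> a = a'.
Proof.
move=> h h'; apply/eqP; rewrite eq_le -(succ_lt _ h) -(succ_lt _ h').
by case: h h' => -> _ [->].
Qed.

Lemma ord_bot : exists o : K, forall a, (o <= a)%O.
Proof.
have [[a _]|/nonemptyPn K0] := pselect ([set: K] !=set0).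
  by have [|o _ omin] := ord_min (A := [set: K]); [exists a|exists o => b; apply: omin].
by case: (ruc_uncountable hK); rewrite K0; exact: countable0.
Qed.

Lemma ord_cases (a : K) :
  [\/ forall b, (a <= b)%O, exists b, is_succ b a | is_limit a].
Proof.
have [[b ba]|na] := pselect (exists b, (b < a)%O); last first.
  by apply: Or31 => b; rewrite leNgt; apply/negP => ba; apply: na; exists b.
have [[c sc]|ns] := pselect (exists b, is_succ b a); first by apply: Or32; exists c.
apply: Or33; split; first by exists b.
move=> c ca; apply: contrapT => nc; apply: ns; exists c; split => // d cd.
by rewrite leNgt; apply/negP => da; apply: nc; exists d.
Qed.

Lemma limit_not_succ (a b : K) : is_limit a -> ~ is_succ b a.
Proof. by move=> [_ la] /[dup] sb [/la[c [bc ca]]] /(_ _ bc); rewrite leNgt ca. Qed.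

Lemma strict_mono_ge (f : K -> K) (a : K) :
  (forall b c, (c < a)%O -> (b < c)%O -> (f b < f c)%O) ->
  forall b, (b < a)%O -> (b <= f b)%O.
Proof.
move=> fm; elim/ord_ind => b IH ba; rewrite leNgt; apply/negP => fb.
by have := IH _ fb (lt_trans fb ba); rewrite leNgt fm.
Qed.

(** The next value may exist only when all earlier ones are correct, so [Step] is a relation.
    Locality lets it act on a history known only below [a]. *)
Lemma ord_recursion (D : Type) (d0 : D) (Step : K -> (K -> D) -> D -> Prop) :
  (forall a F F' d, (forall b, (b < a)%O -> F b = F' b) ->
     Step a F d -> Step a F' d) ->
  (forall a F, (forall b, (b < a)%O -> Step b F (F b)) -> exists d, Step a F d) ->
  exists F, forall a, Step a F (F a).
Proof.
move=> local ext.
pose low (a : K) (r : forall b : K, (b < a)%O -> D) (b : K) :=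
  if pselect (b < a)%O is left h then r b h else d0.
pose body (a : K) (r : forall b : K, (b < a)%O -> D) : D :=
  if pselect (exists d, Step a (low a r) d) is left h then projT1 (cid h) else d0.
pose F := Fix ord_wf (fun=> D) body.
have FE a : F a = body a (fun b _ => F b).
  rewrite /F Fix_eq // => x f g fg; congr body.
  by apply: functional_extensionality_dep => y; apply: functional_extensionality_dep => h.
exists F; elim/ord_ind => a IH.
have lowE b : (b < a)%O -> F b = low a (fun b _ => F b) b.
  by rewrite /low; case: pselect.
rewrite FE /body; case: pselect => [h|[]].
  case: (cid h) => d /= Hd; apply: local Hd => b ba; exact/esym/lowE.
have [d Hd] := ext a F IH; exists d; exact: local Hd.
Qed.

End Ordinals.

Local Open Scope order_scope.
Local Open Scope classical_set_scope.

(** * Maximal antichains and isomorphisms onto relative algebras *)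

Section BooleanAlgebra.
Context {dB : Order.disp_t} {B : ctbDistrLatticeType dB}.
Implicit Types (x y z p q b : B) (P Q A : set B).

Lemma meet_neq0 x y z : z != \bot -> z <= x -> z <= y -> (x `&` y)%O != \bot.
Proof.
move=> z0 zx zy; apply: contra z0 => /eqP xy0.
by rewrite -lex0 -xy0 lexI zx zy.
Qed.

(** A partition of unity, written with common nonzero lower bounds so that no infinite sums
    enter. *)
Record max_antichain P : Prop := {
  ma_neq0 : forall p, P p -> p != \bot;
  ma_eq : forall z p q, z != \bot -> P p -> P q -> z <= p -> z <= q -> p = q;
  ma_meet : forall x, x != \bot ->
    exists z p, [/\ z != \bot, P p, z <= x & z <= p]
}.

Record rel_iso b (f : B -> B) : Prop := {
  ri_le : forall x y, (f x <= f y) = (x <= y);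
  ri_sub : forall x, f x <= b;
  ri_surj : forall y, y <= b -> exists x, f x = y
}.

Lemma ri_inj b f : rel_iso b f -> injective f.
Proof. by move=> fb x y fxy; apply/eqP; rewrite eq_le -(ri_le fb x) -(ri_le fb y) fxy lexx. Qed.

Lemma ri_bot b f : rel_iso b f -> f \bot = \bot.
Proof.
move=> fb; have [x fx] := ri_surj fb (le0x b).
by apply/eqP; rewrite -lex0 -[X in _ <= X]fx (ri_le fb) le0x.
Qed.

Lemma ri_neq0 b f x : rel_iso b f -> (f x != \bot) = (x != \bot).
Proof. by move=> fb; rewrite -{1}(ri_bot fb) (inj_eq (ri_inj fb)). Qed.

Lemma ri_id : rel_iso \top id.
Proof. by split=> [x y//|x|y _]; [exact: lex1|exists y]. Qed.

Lemma ri_comp b c f g : rel_iso b f -> rel_iso c g -> rel_iso (f c) (f \o g).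
Proof.
move=> fb gc; split => [x y|x|y yfc] /=.
- by rewrite (ri_le fb) (ri_le gc).
- by rewrite (ri_le fb) (ri_sub gc).
- have [x fx] := ri_surj fb (le_trans yfc (ri_sub fb c)).
  move: yfc; rewrite -fx (ri_le fb) => /(ri_surj gc)[z gz].
  by exists z; rewrite gz.
Qed.

Lemma ri_factor b x f g : rel_iso b f -> rel_iso (f x) g ->
  exists2 k, rel_iso x k & forall y, g y = f (k y).
Proof.
move=> fb gx; have [|k gk] := choice (P := fun y z => g y = f z).
  move=> y; have [z fz] := ri_surj fb (le_trans (ri_sub gx y) (ri_sub fb x)).
  by exists z.
exists k => //; split => [y z|y|y yx].
- by rewrite -(ri_le fb) -!gk (ri_le gx).
- by rewrite -(ri_le fb) -gk (ri_sub gx).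
- have [|z gz] := ri_surj gx (y := f y); first by rewrite (ri_le fb).
  by exists z; apply: (ri_inj fb); rewrite -gk.
Qed.

(** Partitions wanted below different nodes become partitions of the one algebra [B] and can be
    refined jointly. *)
Lemma ma_pullback P b f : max_antichain P -> rel_iso b f ->
  max_antichain [set x | x != \bot /\ exists2 p, P p & f x = (p `&` b)%O].
Proof.
move=> mP fb; split => [x []//|z x y z0 [_ [p Pp fx]] [_ [q Pq fy]] zx zy|x x0].
  apply: (ri_inj fb); rewrite fx fy; congr (_ `&` _)%O.
  apply: (ma_eq mP (z := f z)) => //; first by rewrite (ri_neq0 _ fb).
    by apply: (@le_trans _ _ (f x)); rewrite ?(ri_le fb)// fx leIl.
  by apply: (@le_trans _ _ (f y)); rewrite ?(ri_le fb)// fy leIl.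
have [|z [p [z0 Pp zx zp]]] := ma_meet mP (x := f x); first by rewrite (ri_neq0 _ fb).
have zb := le_trans zx (ri_sub fb x).
have [w fw] := ri_surj fb (leIr b p : (p `&` b)%O <= b).
have [v fv] := ri_surj fb zb.
exists v, w; rewrite -(ri_neq0 _ fb) -(ri_le fb v x) -(ri_le fb v w) fv fw; split => //.
  split; last by exists p.
  by rewrite -(ri_neq0 _ fb) fw; apply: meet_neq0 z0 zp zb.
by rewrite lexI zp.
Qed.

Lemma ma_meets P Q : max_antichain P -> max_antichain Q ->
  max_antichain [set x | x != \bot /\ exists p q, [/\ P p, Q q & x = (p `&` q)%O]].
Proof.
move=> mP mQ; split => [x []//| z r s z0 [_ [p [q [Pp Qq ->]]]] |x x0].
  move=> [_ [p' [q' [Pp' Qq' ->]]]]; rewrite !lexI => /andP[zp zq] /andP[zp' zq'].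
  by rewrite (ma_eq mP z0 Pp Pp')// (ma_eq mQ z0 Qq Qq').
have [z [p [z0 Pp zx zp]]] := ma_meet mP x0.
have [y [q [y0 Qq yz yq]]] := ma_meet mQ z0.
exists y, (p `&` q)%O; split => //; last by rewrite lexI yq (le_trans yz zp).
- split; last by exists p, q.
  exact: meet_neq0 y0 (le_trans yz zp) yq.
- exact: le_trans yz zx.
Qed.

Lemma homogeneous_ri : homogeneous B ->
  exists G : B -> B -> B, forall b, b != \bot -> rel_iso b (G b).
Proof.
move=> hom; have [|G hG] := choice (P := fun b f => b != \bot -> rel_iso b f); last by exists G.
move=> b; have [->|/eqP b0] := eqVneq b \bot; first by exists id.
have [f [[ff fi fs] _ fI _]] := hom b b0; exists f => _; split => [x y|x|y yb].
- apply/idP/idP => [|xy]; last by rewrite -(meet_l xy) fI leIr.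
  move=> /meet_l; rewrite -fI => /(fi _ _ (mem_set I) (mem_set I)) <-.
  exact: leIr.
- exact: ff.
- by have [x _ <-] := fs y yb; exists x.
Qed.

(** * Infinite sums and products; distributivity as existence of branches *)

Section Complete.
Hypothesis compl : complete_algebra B.

Lemma bprod_glb A y : (y <= bprod A) <-> (forall x, A x -> y <= x).
Proof.
rewrite /bprod /infimum; case: ifPn => [/eqP ->|A0]; first by rewrite lex1.
have [_ [i hi]] := compl A; case: xgetP => [z _ [zl zg]|/(_ i)//].
by split => [yz x /zl /(le_trans yz)|/zg].
Qed.

Lemma bsum_lub A y : (bsum A <= y) <-> (forall x, A x -> x <= y).
Proof.
rewrite /bsum /supremum; case: ifPn => [/eqP ->|A0]; first by rewrite le0x.
have [[i hi] _] := compl A; case: xgetP => [z _ [zl zg]|/(_ i)//].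
by split => [yz x /zl zx|/zg//]; exact: le_trans zx yz.
Qed.

Lemma bprod_le A x : A x -> bprod A <= x.
Proof. by move=> Ax; apply: (iffLR (bprod_glb A _)) Ax. Qed.

Lemma le_bsum A x : A x -> x <= bsum A.
Proof. by move=> Ax; apply: (iffLR (bsum_lub A _)) Ax. Qed.

Context {dK : Order.disp_t} {K : orderType dK}.
Hypothesis distr : distributive_law K B.

(** Every [P i] has sum 1, so distributivity writes 1 as the sum of the products along choice
    functions. If no branch product met [x], all would lie below the complement of [x], forcing [x]
    to be 0. *)
Lemma distr_branch (I : Type) (P : I -> set B) x :
  ~ ([set: K] #<= [set: I]) -> (forall i, max_antichain (P i)) -> x != \bot ->
  exists2 f : I -> B, (forall i, P i (f i)) & (x `&` bprod (range f))%O != \bot.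
Proof.
move=> sI mP x0; apply: contrapT => nf.
(* All of [B] serves as index set; the value 0 off [P i] annihilates choice functions that leave the
   antichains. *)
pose u i j : B := if `[< P i j >] then j else \bot.
have uT i : bsum (range (u i)) = \top.
  apply/eqP; rewrite -le1x -[X in _ <= X]complK lexC compl1 lex0.
  apply/negP => /negP/(ma_meet (mP i))[z [p [z0 Pp zs zp]]].
  move: z0; rewrite -lex0 -(meetxC (bsum (range (u i)))) lexI zs andbT.
  rewrite (le_trans zp)//; apply: le_bsum; exists p => //.
  by rewrite /u; case: asboolP.
have := distr u sI; rewrite (_ : range (fun i => bsum (range (u i))) = [set \top | _ in [set: I]]); last first.
  by apply/seteqP; split => _ [i _ <-]; exists i => //; rewrite uT.
move=> /esym uE; move: x0; rewrite -lex0 -compl1 lexC => /negP[].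
apply: (@le_trans _ _ (bprod [set \top | _ in [set: I]])).
  by apply/bprod_glb => _ [_ _ <-].
rewrite -uE; apply/bsum_lub => _ [f _ <-]; rewrite -disj_leC meetC.
have [fP|/existsNP[i nPi]] := pselect (forall i, P i (f i)).
  apply: contrapT => /negP ne; apply: nf; exists f => //.
  by rewrite (_ : f = fun i => u i (f i))//; apply/funext => i; rewrite /u; case: asboolP.
rewrite -lex0 (le_trans (leIr _ _))//; apply: bprod_le; exists i => //.
by rewrite /u; case: asboolP.
Qed.

(* The nonzero products of the branches through the [P i], [i] in [D],
   described by the order alone so that relative isomorphisms visibly preserve
   them. *)
Definition common_ref (I : Type) (D : set I) (P : I -> set B) : set B :=
  [set u | [/\ u != \bot, forall i, D i -> exists2 p, P i p & u <= p &
    forall y, (forall i, D i -> exists p, [/\ P i p, u <= p & y <= p]) -> y <= u]].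

(** Members with a common nonzero lower bound follow the same branch, hence bound each other;
    [distr_branch] gives maximality. *)
Lemma common_ref_ma (I : Type) (D : set I) (P : I -> set B) :
  ~ ([set: K] #<= D) -> (forall i, D i -> max_antichain (P i)) ->
  max_antichain (common_ref D P).
Proof.
move=> sD mP; split => [u []//|z u v z0 [_ uP ul] [_ vP vl] zu zv|x x0].
  have uv i : D i -> exists p, [/\ P i p, u <= p & v <= p].
    move=> Di; have [p Pp up] := uP i Di; have [q Pq vq] := vP i Di.
    exists p; split => //.
    by rewrite (ma_eq (mP i Di) z0 Pp Pq (le_trans zu up) (le_trans zv vq)).
  apply/eqP; rewrite eq_le vl ?ul// => i /uv[p [? ? ?]]; exists p; split => //.
have [|i|f fP xf] := @distr_branch {i | D i} (fun i => P (sval i)) x _ _ x0.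
- apply: contra_not sD => /card_le_trans; apply.
  apply: (card_le_fun (f := sval)) => [[i Di] _//|[i Di] [j Dj] _ _ /= ij].
  by case: _ / ij Dj => Di'; rewrite (Prop_irrelevance Di Di').
- exact/mP/svalP.
have f0 : bprod (range f) != \bot by apply: contra xf => /eqP ->; rewrite meetx0.
exists (x `&` bprod (range f))%O, (bprod (range f)); split => //; last 2 first.
- exact: leIl.
- exact: leIr.
split => // [i Di|y yP].
  by exists (f (exist _ i Di)); [exact: (fP (exist _ i Di))|apply: bprod_le; exists (exist _ i Di)].
apply/bprod_glb => _ [[i Di] _ <-]; have [p [Pp lp yp]] := yP i Di.
rewrite (ma_eq (mP i Di) f0 (fP (exist _ i Di)) Pp)//.
by apply: bprod_le; exists (exist _ i Di).
Qed.

End Complete.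
End BooleanAlgebra.

(** * Heights of nodes in trees *)

Section Heights.
Context {dK : Order.disp_t} {K : orderType dK}.
Hypothesis hK : regular_uncountable_cardinal K.
Context {V : Type} (X : set V) (lt : V -> V -> Prop).

(** Inverting one enumeration of the predecessors and applying the other gives a strictly increasing
    map that moves [b] downwards, which [strict_mono_ge] forbids. *)
Lemma height_inj x (a b : K) : height X lt x a -> height X lt x b -> a = b.
Proof.
wlog ba : a b / b < a => [hw ha hb|[f [ff fi fs] fm] [g [gf _ _] gm]].
  case: (ltgtP b a) => [ba|ab|//]; first exact: hw.
  by apply/esym/hw.
have [|F hF] := choice (P := fun c y => c < a -> preds X lt x y /\ f y = c).
  move=> c; have [/fs[y py fy]|nca] := pselect (c < a); first by exists y.
  by exists x => /nca.
have gb : g (F b) < b by apply: gf; case: (hF b ba).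
have gF c d : d < a -> c < d -> (g \o F) c < (g \o F) d.
  move=> da cd; have [pc fc] := hF c (lt_trans cd da); have [pd fd] := hF d da.
  by apply/gm => //; apply/fm => //; rewrite fc fd.
by have := strict_mono_ge hK gF ba; rewrite leNgt /= gb.
Qed.

Hypothesis tr : is_tree X lt.

Lemma height_pred x y (f : V -> K) (a : K) : X x -> preds X lt x y ->
  set_bij (preds X lt x) (below a) f ->
  (forall y z, preds X lt x y -> preds X lt x z -> lt y z <-> f y < f z) ->
  height X lt y (f y).
Proof.
move=> Xx xy [ff fi fs] fm; case: (xy) => Xy yx.
have sub z : preds X lt y z -> preds X lt x z.
  by case=> Xz zy; split => //; exact: (tree_trans tr Xz Xy Xx).
exists f => [|z w /sub pz /sub pw]; last exact: fm.
split => [z yz|z w /set_mem/sub/mem_set pz /set_mem/sub/mem_set pw|c cy].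
- by apply/fm => //; [exact: sub|case: yz].
- exact: fi.
- have [z pz zc] := fs c (lt_trans cy (ff _ xy)); exists z => //.
  by split; [case: pz|apply/fm => //; rewrite zc].
Qed.

Lemma pred_at_height x (a b : K) : X x -> height X lt x b -> a < b ->
  exists2 y, level X lt a y & lt y x.
Proof.
move=> Xx [f fb fm] ab; have [_ _ fs] := fb; have [y xy <-] := fs a ab.
have [Xy yx] := xy; exists y => //; split => //; exact: height_pred fb fm.
Qed.

Lemma height_lt x y (a b : K) : level X lt a x -> level X lt b y -> lt x y -> a < b.
Proof.
move=> [Xx hx] [Xy [f fb fm]] xy; have [ff _ _] := fb.
have pyx : preds X lt y x by [].
by rewrite (height_inj hx (height_pred Xy pyx fb fm)); exact: ff.
Qed.

Lemma preds_linear x y z : X x -> preds X lt x y -> preds X lt x z ->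
  [\/ y = z, lt y z | lt z y].
Proof.
move=> Xx xy xz; have [_ [->|->]//||w wyz wmin] := tree_wo tr Xx (A := [set y; z]).
  by exists y; left.
case: wyz wmin => -> wmin.
- by case: (wmin z); [right|move=> ->; apply: Or31|apply: Or32].
- by case: (wmin y); [left|move=> ->; apply: Or31|apply: Or33].
Qed.

End Heights.

(** * Levels of the given Souslinization and the cut into two halves *)

Section Souslinization.
Context {dK : Order.disp_t} {K : orderType dK}.
Hypothesis hK : regular_uncountable_cardinal K.
Context {dB : Order.disp_t} {B : ctbDistrLatticeType dB}.
Implicit Types x y z p q c e : B.

(** Density puts a tree node [t] below any nonzero element. Two nodes of level [a] above [t] are
    comparable, hence equal; and [t] has a predecessor on level [a], lies on it, or extends to
    it. *)
Lemma souslinization_levels (T : set B) (a : K) :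
  souslinization K T -> max_antichain (level T (@above _ B) a).
Proof.
move=> sT; have nT := st_normal (sz_tree sT); have tT := kn_tree nT.
have T0 t : T t -> t != \bot by move=> Tt; apply/eqP => t0; apply: (sz_nonzero sT); rewrite -t0.
split => [p [/T0//]|z p q z0 lp lq zp zq|x /eqP/(sz_dense sT)[t Tt tx]].
  have [t Tt tz] := sz_dense sT (elimN eqP z0).
  have nlt p' q' : level T (@above _ B) a p' -> level T (@above _ B) a q' -> ~ above p' q'.
    by move=> lp' lq' /(height_lt hK tT lp' lq'); rewrite ltxx.
  have := le_trans tz zp; rewrite le_eqVlt => /predU1P[tp|tp];
    have := le_trans tz zq; rewrite le_eqVlt => /predU1P[tq|tq].
  - by rewrite -tp -tq.
  - by case: (nlt q p lq lp); rewrite -tp.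
  - by case: (nlt p q lp lq); rewrite -tq.
  - have [lp1 _] := lp; have [lq1 _] := lq.
    by have [//| /nlt | /nlt] := preds_linear tT Tt (conj lp1 tp) (conj lq1 tq); case.
have [b hb] := kn_height nT Tt.
case: (ltgtP a b) => [ab|ba|ab].
- have [y ly ty] := pred_at_height tT Tt hb ab.
  by exists t, y; split => //; [exact: T0|exact: ltW].
- have [s ls st] := kn_ext nT ba (conj Tt hb) (st_height (sz_tree sT) a).
  exists s, s; split => //; first by case: ls => /T0.
  exact: le_trans (ltW st) tx.
- by exists t, t; rewrite ab; split => //; exact: T0.
Qed.

Lemma souslinization_atomless (T : set B) : souslinization K T ->
  forall x, x != \bot -> exists2 y, y != \bot & y < x.
Proof.
move=> sT x /eqP/(sz_dense sT)[t Tt tx]; have nT := st_normal (sz_tree sT).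
have [a ha] := kn_height nT Tt; have [b [ab _]] := ord_succ hK a.
have [s [Ts _] st] := kn_ext nT ab (conj Tt ha) (st_height (sz_tree sT) b).
exists s; last exact: lt_le_trans st tx.
by apply/eqP => s0; apply: (sz_nonzero sT); rewrite -s0.
Qed.

Definition refines (Q P : set B) := forall q, Q q -> exists2 p, P p & q <= p.

Lemma refine2 (P Q : set B) : max_antichain P -> max_antichain Q ->
  exists R : set B, [/\ max_antichain R, refines R P & refines R Q].
Proof.
move=> mP mQ; eexists; split; first exact: ma_meets mP mQ.
- by move=> _ [_ [p [q [Pp Qq ->]]]]; exists p => //; exact: leIl.
- by move=> _ [_ [p [q [Pp Qq ->]]]]; exists q => //; exact: leIr.
Qed.

Lemma refines_trans (P Q R : set B) : refines P Q -> refines Q R -> refines P R.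
Proof. by move=> PQ QR p /PQ[q /QR[r Rr qr] pq]; exists r => //; exact: le_trans pq qr. Qed.

Lemma ma_compl c : c != \bot -> (~` c)%O != \bot -> max_antichain ([set c; (~` c)%O] : set B).
Proof.
move=> c0 nc0; have cc z : z != \bot -> z <= c -> z <= (~` c)%O -> False.
  by move=> z0 zc znc; have := meet_neq0 z0 zc znc; rewrite meetxC eqxx.
split => [_ [->|->]//|z _ _ z0 [->|->] [->|->] // zp zq|x x0].
- by case: (cc z).
- by case: (cc z).
- have [xc|xc] := eqVneq (x `&` c)%O \bot; last first.
    by exists (x `&` c)%O, c; split => //; [left|exact: leIl|exact: leIr].
  by exists x, (~` c)%O; split => //; [right|rewrite -disj_leC xc].
Qed.

Lemma ma_decides (Q : set B) c q z : refines Q [set c; (~` c)%O] -> Q q ->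
  z != \bot -> z <= q -> z <= c -> q <= c.
Proof.
move=> Qc /Qc[_ [->//|->] qc] z0 zq zc.
by have := meet_neq0 z0 zc (le_trans zq qc); rewrite meetxC eqxx.
Qed.

(** With [e] strictly between 0 and 1, [d] strictly inside [e] and [d'] strictly inside its
    complement, [S] is made to decide all three. *)
Lemma two_halves : (forall x, x != \bot -> exists2 y, y != \bot & y < x) ->
  (\top : B) != \bot ->
  exists (e : B) (S : set B), max_antichain S /\ forall Q, max_antichain Q -> refines Q S ->
    forall b : bool, exists q q', [/\ Q q, Q q', q <> q', (q <= e) = b & (q' <= e) = b].
Proof.
move=> atl top0; have [e e0 e1] := atl _ top0.
have nz x y : y < x -> (x `&` ~` y)%O != \bot.
  by move=> yx; rewrite disj_leC complK lt_geF.
have ne0 : (~` e)%O != \bot by have := nz _ _ e1; rewrite meet1x.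
have [d d0 de] := atl _ e0; have [d' d'0 d'e] := atl _ ne0.
have nzc x y : y < x -> (~` y)%O != \bot.
  by move=> /nz; apply: contra => /eqP ->; rewrite meetx0.
have [R [mR Re Rd]] := refine2 (ma_compl e0 ne0) (ma_compl d0 (nzc _ _ de)).
have [S [mS SR Sd']] := refine2 mR (ma_compl d'0 (nzc _ _ d'e)).
exists e, S; split => // Q mQ QS.
have QR := refines_trans QS SR.
have Qe := refines_trans QR Re; have Qd := refines_trans QR Rd.
have Qd' := refines_trans QS Sd'.
(* One piece meets [y] and one meets [x] minus [y]; no piece meets both, since [Q] decides [y]. *)
have two x y : y != \bot -> y < x -> refines Q [set y; (~` y)%O] ->
    exists q q', [/\ Q q, Q q', q <> q', exists2 z, z != \bot & z <= q /\ z <= x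
       & exists2 z, z != \bot & z <= q' /\ z <= x].
  move=> y0 yx Qy; have [z [q [z0 Qq zy zq]]] := ma_meet mQ y0.
  have [z' [q' [z'0 Qq' ]]] := ma_meet mQ (nz _ _ yx); rewrite lexI => /andP[z'x z'y] z'q.
  exists q, q'; split => //; last 2 first.
  - by exists z => //; split => //; exact: le_trans zy (ltW yx).
  - by exists z'.
  move=> qq; have qy := ma_decides Qy Qq z0 zq zy.
  by have := meet_neq0 z'0 (le_trans z'q _) z'y; rewrite -qq => /(_ _ qy); rewrite meetxC eqxx.
case.
- have [q [q' [Qq Qq' qq [z z0 [zq ze]] [z' z'0 [z'q z'e]]]]] := two _ _ d0 de Qd.
  by exists q, q'; split => //; [exact: (ma_decides Qe Qq z0)|exact: (ma_decides Qe Qq' z'0)].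
- have [q [q' [Qq Qq' qq [z z0 [zq ze]] [z' z'0 [z'q z'e]]]]] := two _ _ d'0 d'e Qd'.
  exists q, q'; split => //; apply/negP => qe.
    by have := meet_neq0 z0 (le_trans zq qe) ze; rewrite meetxC eqxx.
  by have := meet_neq0 z'0 (le_trans z'q qe) z'e; rewrite meetxC eqxx.
Qed.

End Souslinization.

(** * Recursive construction of the levels and their isomorphisms *)

Section Construction.
Context {dK : Order.disp_t} {K : orderType dK}.
Hypothesis hK : regular_uncountable_cardinal K.
Context {dB : Order.disp_t} {B : ctbDistrLatticeType dB}.
Hypothesis compl : complete_algebra B.
Hypothesis distr : distributive_law K B.
Hypothesis cc : chain_condition K B.
Hypothesis top0 : (\top : B) != \bot.
Context (G : B -> B -> B).
Hypothesis hG : forall b, b != \bot -> rel_iso b (G b).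
Context (W : K -> set B).
Hypothesis hW : forall a, max_antichain (W a).
Context (e : B) (S : set B).
Hypothesis mS : max_antichain S.
Hypothesis halves : forall Q, max_antichain Q -> refines Q S ->
  forall b : bool, exists q q', [/\ Q q, Q q', q <> q', (q <= e) = b & (q' <= e) = b].
Implicit Types (a b c : K) (s t u x y z q : B).

(* A level of the new tree, with an isomorphism [B -> B|s] for each node [s] and
   the bit that tells to which of the two quotient successors a node of
   successor height belongs. *)
Record level_data := LevelData {
  nodes : set B;
  iso : B -> B -> B;
  bit : B -> bool
}.

(** The map meant is [iso L t] after the inverse of [iso L s]; the shared argument [x] avoids naming
    the inverse. The last clause makes the isomorphisms between nodes of [M] restrictions of this
    map. *)
Definition coherent (L M : level_data) : Prop :=
  forall s t x, nodes L s -> nodes L t -> nodes M (iso L s x) ->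
  [/\ nodes M (iso L t x), bit M (iso L t x) = bit M (iso L s x) &
      forall y z, iso M (iso L s x) y = iso L s z ->
                  iso M (iso L t x) y = iso L t z].

(** One record serves all heights. [step_limit] also covers the least height, where the condition on
    [y] is void and forces the only node to be 1. *)
Record step (a : K) (F : K -> level_data) (L : level_data) : Prop := Step {
  step_ma : max_antichain (nodes L);
  step_iso : forall s, nodes L s -> rel_iso s (iso L s);
  step_refines : forall b, b < a -> refines (nodes L) (nodes (F b));
  step_coherent : forall b, b < a -> coherent (F b) L;
  step_dense : forall b, is_succ b a -> refines (nodes L) (W b);
  step_split : forall b s, is_succ b a -> nodes (F b) s -> forall i : bool,
    exists u v, [/\ nodes L u /\ nodes L v, u <> v, u <= s /\ v <= s
      & bit L u = i /\ bit L v = i];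
  step_limit : (forall b, ~ is_succ b a) -> forall u, nodes L u ->
    bit L u = false /\
    forall y, (forall c, c < a -> exists p, [/\ nodes (F c) p, u <= p & y <= p]) ->
      y <= u
}.

Lemma step_local a F F' L : (forall b, b < a -> F b = F' b) ->
  step a F L -> step a F' L.
Proof.
move=> FF' [h1 h2 h3 h4 h5 h6 h7]; split => //.
- by move=> b ba; rewrite -FF'//; exact: h3.
- by move=> b ba; rewrite -FF'//; exact: h4.
- by move=> b s sb; rewrite -FF'; [exact: h6|case: sb].
- move=> ns u Lu; have [bu hu] := h7 ns u Lu; split => // y hy; apply: hu => c ca.
  by rewrite FF'//; exact: hy.
Qed.

Lemma ma_small (P : set B) : max_antichain P -> ~ ([set: K] #<= P).
Proof.
move=> mP; apply: cc => [p /(ma_neq0 mP)/eqP//|p q Pp Pq pq].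
apply/eqP; apply: contrapT => /negP pq0; apply: pq.
by apply: (ma_eq mP pq0) => //; [exact: leIl|exact: leIr].
Qed.

Section Step.
Context (a : K) (F : K -> level_data).
Hypothesis IH : forall b, b < a -> step b F (F b).

Let ma b : b < a -> max_antichain (nodes (F b)).
Proof. by move=> /IH/step_ma. Qed.

Let ri b s : b < a -> nodes (F b) s -> rel_iso s (iso (F b) s).
Proof. by move=> /IH/step_iso; apply. Qed.

(** The node [s'] meets [s], so it lies below [s] and is the image of some [x']; the node sought is
    [iso (F b) t x']. Coherence in both directions gives the equivalence: [s'] and [t'] sit below
    [s] and [t] through the same map. *)
Lemma iso_lift b c s t x s' : b <= c -> c < a -> nodes (F b) s ->
  nodes (F b) t -> x != \bot -> nodes (F c) s' -> iso (F b) s x <= s' ->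
  exists2 t', nodes (F c) t' /\ iso (F b) t x <= t' &
    forall y z, iso (F c) s' y = iso (F b) s z <-> iso (F c) t' y = iso (F b) t z.
Proof.
rewrite le_eqVlt => /predU1P[<- ba Ps Pt x0 Ps' xs'|bc ca Ps Pt x0 Ps' xs'].
  have sx0 : iso (F b) s x != \bot by rewrite (ri_neq0 _ (ri ba Ps)).
  rewrite (ma_eq (ma ba) sx0 Ps' Ps xs' (ri_sub (ri ba Ps) x)).
  exists t; first by split => //; exact: ri_sub (ri ba Pt) _.
  by move=> y z; split => [/(ri_inj (ri ba Ps)) ->|/(ri_inj (ri ba Pt)) ->].
have ba := lt_trans bc ca.
have sx0 : iso (F b) s x != \bot by rewrite (ri_neq0 _ (ri ba Ps)).
have [s1 Ps1 ss1] := step_refines (IH ca) bc Ps'.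
have s1s := ma_eq (ma ba) sx0 Ps1 Ps (le_trans xs' ss1) (ri_sub (ri ba Ps) x).
have [x' s'E] := ri_surj (ri ba Ps) (eq_ind _ (fun v => s' <= v) ss1 _ s1s).
move: Ps' xs'; rewrite -s'E (ri_le (ri ba Ps)) => Ps' xx'.
have [Pt' _ st] := step_coherent (IH ca) bc Ps Pt Ps'.
have [_ _ ts] := step_coherent (IH ca) bc Pt Ps Pt'.
exists (iso (F b) t x') => [|y z]; first by rewrite (ri_le (ri ba Pt)).
by split; [exact: st|exact: ts].
Qed.

Lemma step_bottom : (forall b, a <= b) -> exists L, step a F L.
Proof.
move=> a0; have na b : ~ b < a by rewrite ltNge a0.
exists (LevelData [set \top] (fun=> id) (fun=> false)); split => /=.
- split => [_ ->//|z _ _ _ -> ->//|x x0].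
  by exists x, \top; split => //; exact: lex1.
- by move=> _ ->; exact: ri_id.
- by move=> b /na.
- by move=> b /na.
- by move=> b [/na].
- by move=> b s [/na].
- by move=> _ _ ->; split => // y _; exact: lex1.
Qed.

Lemma step_successor b : is_succ b a -> exists L, step a F L.
Proof.
move=> sb; have ba : b < a by case: sb.
have mb := ma ba; have rb s := @ri b s ba.
(* [P s] pulls the trace of [W b] on [s] back to [B]. By the chain condition the level has fewer
   than kappa nodes, so a single [Q] can refine all [P s] and also [S]. *)
pose P s : set B := [set x : B | x != \bot /\ exists2 p, W b p & iso (F b) s x = (p `&` s)%O].
have mP : max_antichain (common_ref (nodes (F b)) P).
  apply: (common_ref_ma compl distr) => [|s Ps]; first exact: ma_small.
  by apply: ma_pullback => //; exact: rb.
have [Q [mQ QP QS]] := refine2 mP mS.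
pose N u := exists s q, [/\ nodes (F b) s, Q q & u = iso (F b) s q].
have q0 q : Q q -> q != \bot by exact: ma_neq0.
have Nuniq z s s' q q' : z != \bot -> nodes (F b) s -> nodes (F b) s' -> Q q -> Q q' ->
    z <= iso (F b) s q -> z <= iso (F b) s' q' -> s = s' /\ q = q'.
  move=> z0 Ps Ps' Qq Qq' zq zq'.
  have ss' : s = s'.
    apply: (ma_eq mb z0) => //; first exact: le_trans zq (ri_sub (rb _ Ps) _).
    exact: le_trans zq' (ri_sub (rb _ Ps') _).
  rewrite -ss' in zq' *; split => //.
  have [w wz] := ri_surj (rb _ Ps) (le_trans zq (ri_sub (rb _ Ps) _)).
  move: z0 zq zq'; rewrite -wz (ri_neq0 _ (rb _ Ps)) !(ri_le (rb _ Ps)) => w0 wq wq'.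
  exact: (ma_eq mQ w0).
(* The pick depends on writing [u] as [iso (F b) s q]; by [Nuniq] this is possible in one way only,
   so [fbE] computes it. *)
have [|fb hfb] := choice (P := fun u fb => N u -> exists s q,
    [/\ nodes (F b) s, Q q, u = iso (F b) s q &
        fb = (iso (F b) s \o G q, q <= e) :> (B -> B) * bool]).
  move=> u; have [[s [q [Ps Qq uE]]]|nNu] := pselect (N u).
    by exists (iso (F b) s \o G q, q <= e) => _; exists s, q.
  by exists (id, true) => /nNu.
have fbE s q : nodes (F b) s -> Q q ->
    fb (iso (F b) s q) = (iso (F b) s \o G q, q <= e).
  move=> Ps Qq; have [|s' [q' [Ps' Qq' sq ->]]] := hfb (iso (F b) s q).
    by exists s, q.
  have sq0 : iso (F b) s q != \bot by rewrite (ri_neq0 _ (rb _ Ps)) q0.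
  have [||-> -> //] := Nuniq _ s s' q q' sq0 Ps Ps' Qq Qq'; first exact: lexx.
  by rewrite -sq lexx.
have coh : coherent (F b) (LevelData N (fun u => (fb u).1) (fun u => (fb u).2)).
  move=> s t x Ps Pt /= [s' [q [Ps' Qq sxE]]].
  have sq0 : iso (F b) s' q != \bot by rewrite (ri_neq0 _ (rb _ Ps')) q0.
  have ss' : s = s'.
    apply: (ma_eq mb sq0) => //; last exact: ri_sub (rb _ Ps') _.
    by rewrite -sxE; exact: ri_sub (rb _ Ps) _.
  rewrite -ss' in sxE; rewrite (ri_inj (rb _ Ps) sxE) !fbE//=.
  split => // [|y z /(ri_inj (rb _ Ps)) ->//]; by exists t, q.
exists (LevelData N (fun u => (fb u).1) (fun u => (fb u).2)); split => /=.
- split => [u [s [q [Ps Qq ->]]]|z u v z0 [s [q [Ps Qq ->]]] [s' [q' [Ps' Qq' ->]]]|x x0].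
  + by rewrite (ri_neq0 _ (rb _ Ps)) q0.
  + by move=> zu zv; have [-> ->] := Nuniq z s s' q q' z0 Ps Ps' Qq Qq' zu zv.
  + have [z [s [z0 Ps zx zs]]] := ma_meet mb x0.
    have [w wz] := ri_surj (rb _ Ps) zs.
    have [|v [q [v0 Qq vw vq]]] := ma_meet mQ (x := w).
      by rewrite -(ri_neq0 _ (rb _ Ps)) wz.
    exists (iso (F b) s v), (iso (F b) s q).
    rewrite (ri_neq0 _ (rb _ Ps)) (ri_le (rb _ Ps)); split => //.
      by exists s, q.
    by apply: le_trans zx; rewrite -wz (ri_le (rb _ Ps)).
- move=> u [s [q [Ps Qq ->]]]; rewrite fbE//=.
  by apply: ri_comp; [exact: rb|exact/hG/q0].
- move=> c; rewrite (succ_lt c sb) le_eqVlt => /predU1P[->|cb] u [s [q [Ps Qq ->]]].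
    by exists s => //; exact: ri_sub (rb _ Ps) _.
  have [p Pp sp] := step_refines (IH ba) cb Ps; exists p => //.
  exact: le_trans (ri_sub (rb _ Ps) _) sp.
(* For [c] below [b], [iso_lift] leads to nodes [s1], [t1] of level [b], where [coh] applies. *)
- move=> c; rewrite (succ_lt c sb) le_eqVlt => /predU1P[->//|cb] s t x Ps Pt Nsx.
  have ca := lt_trans cb ba; have [s1 [q [Ps1 Qq sxE]]] := Nsx.
  have x0 : x != \bot.
    by rewrite -(ri_neq0 _ (ri ca Ps)) sxE (ri_neq0 _ (rb _ Ps1)) q0.
  have [|t1 [Pt1 _] lift] := iso_lift (ltW cb) ba Ps Pt x0 Ps1.
    by rewrite sxE; exact: ri_sub (rb _ Ps1) _.
  have txE := iffLR (lift q x) (esym sxE).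
  rewrite /= sxE in Nsx *; have [Nt1 bt1 c1] := coh s1 t1 q Ps1 Pt1 Nsx.
  rewrite -txE; split => // y z; rewrite /= !fbE//= => yz.
  exact/lift.
- move=> c sc; rewrite -(succ_inj sb sc) => _ [s [q [Ps Qq ->]]].
  have [x [_ xP _] qx] := QP q Qq; have [p [_ [w Ww pE]] xp] := xP s Ps.
  exists w => //; apply: (@le_trans _ _ (iso (F b) s p)).
    by rewrite (ri_le (rb _ Ps)) (le_trans qx).
  by rewrite pE leIl.
- move=> c s sc; rewrite -(succ_inj sb sc) => Ps i.
  have [q [q' [Qq Qq' qq' qi q'i]]] := halves mQ QS i.
  exists (iso (F b) s q), (iso (F b) s q'); rewrite !fbE//=; split => //.
  + by split; [exists s, q|exists s, q'].
  + by move=> /(ri_inj (rb _ Ps)).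
  + by split; exact: ri_sub (rb _ Ps) _.
- by move=> /(_ b).
Qed.

(** The tie between limit nodes, witnessed at one lower level. By [sim_later] it persists at all
    later levels below [a], whence transitivity. *)
Definition sim (s t : B) : Prop := exists b s0 t0 x,
  [/\ b < a, nodes (F b) s0 /\ nodes (F b) t0,
      s = iso (F b) s0 x & t = iso (F b) t0 x].

Let N := common_ref (below a) (fun b => nodes (F b)).

Let N0 s : N s -> s != \bot. Proof. by case. Qed.

Let N_above s b : N s -> b < a -> exists2 p, nodes (F b) p & s <= p.
Proof. by case=> _ sP _; exact: sP. Qed.

(** From level [b] on, [iso_lift] matches the nodes above the two elements, so maximality transfers;
    at levels below [b] the nodes above [s] and [t] do. *)
Lemma common_ref_iso b s t x : b < a -> nodes (F b) s -> nodes (F b) t ->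
  N (iso (F b) s x) -> N (iso (F b) t x).
Proof.
move=> ba Ps Pt [sx0 sxP sxl].
have tx0 : iso (F b) t x != \bot by rewrite (ri_neq0 _ (ri ba Pt)) -(ri_neq0 _ (ri ba Ps)).
have x0 : x != \bot by rewrite -(ri_neq0 _ (ri ba Ps)).
split => // [c /= ca|y yP].
  have [bc|cb] := leP b c.
    have [p Pp sxp] := sxP c ca.
    by have [p' [Pp' tp'] _] := iso_lift bc ca Ps Pt x0 Pp sxp; exists p'.
  have [p Pp tp] := step_refines (IH ba) cb Pt; exists p => //.
  exact: le_trans (ri_sub (ri ba Pt) _) tp.
have [p [Pp txp yp]] := yP b ba.
have pt : p = t := ma_eq (ma ba) tx0 Pp Pt txp (ri_sub (ri ba Pt) _).
rewrite pt in yp; have [z zy] := ri_surj (ri ba Pt) yp.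
rewrite -zy (ri_le (ri ba Pt)) -(ri_le (ri ba Ps)); apply: sxl => c /= ca.
have [bc|cb] := leP b c.
  have [q [Pq txq yq]] := yP c ca.
  have [q' [Pq' sq'] lift] := iso_lift bc ca Pt Ps x0 Pq txq.
  exists q'; split => //; have [w qw] := ri_surj (ri ca Pq) yq.
  have -> : iso (F b) s z = iso (F c) q' w by apply/esym/lift; rewrite qw.
  exact: ri_sub (ri ca Pq') _.
have [q Pq sq] := step_refines (IH ba) cb Ps; exists q.
by split => //; apply: le_trans sq; exact: ri_sub (ri ba Ps) _.
Qed.

Lemma sim_later s t : s != \bot -> sim s t -> exists2 b, b < a &
  forall c s1 t1, b <= c -> c < a -> nodes (F c) s1 -> nodes (F c) t1 ->
    s <= s1 -> t <= t1 -> exists2 x, s = iso (F c) s1 x & t = iso (F c) t1 x.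
Proof.
move=> sn0 [b [s0 [t0 [x [ba [Ps0 Pt0] sE tE]]]]]; exists b => // c s1 t1 bc ca Ps1 Pt1 ss1 tt1.
have x0 : x != \bot by rewrite -(ri_neq0 _ (ri ba Ps0)) -sE.
have tn0 : t != \bot by rewrite tE (ri_neq0 _ (ri ba Pt0)).
rewrite sE in ss1; have [t' [Pt' tt'] lift] := iso_lift bc ca Ps0 Pt0 x0 Ps1 ss1.
rewrite -tE in tt'; have tE' : t1 = t' := ma_eq (ma ca) tn0 Pt1 Pt' tt1 tt'.
have [y yE] := ri_surj (ri ca Ps1) ss1; exists y; first by rewrite sE.
by rewrite tE tE'; apply/esym/lift.
Qed.

Lemma sim_sym s t : sim s t -> sim t s.
Proof. by move=> [b [s0 [t0 [x [ba [? ?] ? ?]]]]]; exists b, t0, s0, x. Qed.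

Lemma sim_trans s t u : N s -> N t -> N u -> sim s t -> sim t u -> sim s u.
Proof.
move=> Ns Nt Nu /(sim_later (N0 Ns))[b ba st] /(sim_later (N0 Nt))[c ca tu].
have da : Order.max b c < a by rewrite gt_max ba.
have [s1 Ps1 ss1] := N_above Ns da; have [t1 Pt1 tt1] := N_above Nt da.
have [u1 Pu1 uu1] := N_above Nu da.
have [|x sx tx] := st _ s1 t1 _ da Ps1 Pt1 ss1 tt1; first by rewrite le_max lexx.
have [|y ty uy] := tu _ t1 u1 _ da Pt1 Pu1 tt1 uu1; first by rewrite le_max lexx orbT.
exists (Order.max b c), s1, u1, x; split => //.
by rewrite uy; congr (iso _ _ _); apply: (ri_inj (ri da Pt1)); rewrite -ty.
Qed.

(** Depends only on the class of [s], since [xget] returns the same element for equal sets. *)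
Let rep s : B := xget \bot [set t | N t /\ sim s t].

Lemma rep_sim s : sim s s -> N s -> N (rep s) /\ sim s (rep s).
Proof. by move=> ss Ns; apply: (@xgetI _ \bot [set t | N t /\ sim s t] s). Qed.

Lemma rep_eq s t : N s -> N t -> sim s t -> rep s = rep t.
Proof.
move=> Ns Nt st; congr (xget _ _); apply/seteqP; split => u [Nu su]; split => //.
  exact: sim_trans (sim_sym st) su.
exact: sim_trans st su.
Qed.

(* [f] carries the isomorphism chosen for the representative of [s] along the
   isomorphisms of the levels below. *)
Let along s (f : B -> B) := rel_iso s f /\ exists2 b, b < a &
  forall c s' r', b <= c -> c < a -> nodes (F c) s' -> nodes (F c) r' ->
    s <= s' -> rep s <= r' ->
    forall y w, G (rep s) y = iso (F c) r' w -> f y = iso (F c) s' w.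

Lemma along_exists s : sim s s -> N s -> exists f, along s f.
Proof.
move=> ss Ns; have [Nr] := rep_sim ss Ns; rewrite /along; set r := rep s in Nr *.
move=> [b [s0 [r0 [x [ba [Ps0 Pr0] sE rE]]]]].
have x0 : x != \bot by rewrite -(ri_neq0 _ (ri ba Ps0)) -sE N0.
have := hG (N0 Nr); rewrite {1}rE => hGr.
(* The isomorphism chosen for [r] is [iso (F b) r0] after [k]; the same [k] followed by
   [iso (F b) s0] carries it to [s]. *)
have [k kx kE] := ri_factor (ri ba Pr0) hGr.
exists (iso (F b) s0 \o k); split; first by rewrite sE; exact: ri_comp (ri ba Ps0) kx.
exists b => // c s' r' bc ca Ps' Pr' ss' rr' y w; rewrite kE /= => /esym yw.
rewrite rE in rr'; have [t' [Pt' st'] lift] := iso_lift bc ca Pr0 Ps0 x0 Pr' rr'.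
rewrite -sE in st'.
by rewrite (ma_eq (ma ca) (N0 Ns) Ps' Pt' ss' st'); apply/esym/lift.
Qed.

Lemma step_limit_exists : is_limit a -> exists L, step a F L.
Proof.
move=> la; have [[b0 b0a] _] := la.
have simxx s : N s -> sim s s.
  move=> Ns; have [p Pp sp] := N_above Ns b0a.
  by have [x px] := ri_surj (ri b0a Pp) sp; exists b0, p, p, x.
have [|f hf] := choice (P := fun s f => N s -> along s f).
  move=> s; have [Ns|nN] := pselect (N s); last by exists id => /nN.
  by have [f hf] := along_exists (simxx s Ns) Ns; exists f.
exists (LevelData N f (fun=> false)); split => /=.
- apply: (common_ref_ma compl distr) => [|b ba]; last exact: ma.
  exact: ruc_cardinal hK a.
- by move=> s /hf[].
- by move=> b ba u Nu; exact: N_above.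
- move=> b ba s0 t0 x Ps0 Pt0 /= Ns; have Nt := common_ref_iso ba Ps0 Pt0 Ns.
  split => //; have x0 : x != \bot by rewrite -(ri_neq0 _ (ri ba Ps0)) N0.
  set s := iso (F b) s0 x in Ns *; set t := iso (F b) t0 x in Nt *.
  have rE : rep s = rep t by apply: rep_eq => //; exists b, s0, t0, x.
  have [[fs [b1 b1a hs]] [ft [b2 b2a ht]]] := (hf s Ns, hf t Nt).
  (* Beyond [b] and both thresholds, the two isomorphisms are read off the same [G (rep s) y], and
     [lift] compares them. *)
  set c := Order.max b (Order.max b1 b2).
  have ca : c < a by rewrite !gt_max ba b1a.
  have [s' Ps' ss'] := N_above Ns ca; have [t' Pt' tt'] := N_above Nt ca.
  have [Nr _] := rep_sim (simxx s Ns) Ns; have [r' Pr' rr'] := N_above Nr ca.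
  have bc : b <= c by rewrite le_max lexx.
  have [t'' [Pt'' tt''] lift] := iso_lift bc ca Ps0 Pt0 x0 Ps' ss'.
  have tE : t' = t'' := ma_eq (ma ca) (N0 Nt) Pt' Pt'' tt' tt''.
  move=> y z; have [w /esym yw] := ri_surj (ri ca Pr') (le_trans (ri_sub (hG (N0 Nr)) y) rr').
  rewrite (hs c s' r' _ ca Ps' Pr' ss' rr' y w yw); last by rewrite !le_max lexx orbT.
  rewrite rE in rr' yw.
  rewrite (ht c t' r' _ ca Pt' Pr' tt' rr' y w yw); last by rewrite !le_max lexx !orbT.
  by rewrite tE => /lift.
- by move=> b /(limit_not_succ la).
- by move=> b s /(limit_not_succ la).
- by move=> _ u [_ _ ul].
Qed.

End Step.

Lemma levels_exist : exists F : K -> level_data, forall a, step a F (F a).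
Proof.
apply: (ord_recursion hK (LevelData set0 (fun=> id) (fun=> false)) step_local).
move=> a F IH; have [|[b]|] := ord_cases a.
- exact: step_bottom.
- exact: step_successor.
- exact: step_limit_exists.
Qed.

End Construction.

(** * Trees with a prescribed rank *)

Section RankedTrees.
Context {dK : Order.disp_t} {K : orderType dK}.
Hypothesis hK : regular_uncountable_cardinal K.
Context {V : Type} (X : set V) (lt : V -> V -> Prop) (L : K -> set V).

(** Conditions making a prescribed family [L] the levels of the tree; they serve both the new tree
    and its quotient. *)
Record ranked : Prop := {
  rk_nodes : forall x, X x <-> exists a, L a x;
  rk_inj : forall a b x, L a x -> L b x -> a = b;
  rk_trans : forall x y z, X x -> X y -> X z -> lt x y -> lt y z -> lt x z;
  rk_lt : forall a b x y, L a x -> L b y -> lt x y -> a < b;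
  rk_pred : forall a b y, L b y -> a < b -> exists2 x, L a x & lt x y;
  rk_uniq : forall a x x' y, X y -> L a x -> L a x' -> lt x y -> lt x' y -> x = x'
}.

Hypothesis rk : ranked.

Let LX a x : L a x -> X x.
Proof. by move=> Lx; apply/(rk_nodes rk); exists a. Qed.

Lemma ranked_preds_lt a b x y z : L a x -> L b y -> a < b -> X z ->
  lt x z -> lt y z -> lt x y.
Proof.
move=> Lx Ly ab Xz xz yz; have [w Lw wy] := rk_pred rk Ly ab.
have wz : lt w z by exact: (rk_trans rk (LX Lw) (LX Ly)).
by rewrite (rk_uniq rk Xz Lx Lw xz wz).
Qed.

Lemma ranked_tree : is_tree X lt.
Proof.
split.
- move=> x /(rk_nodes rk)[a Lx] /(rk_lt rk Lx Lx); by rewrite ltxx.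
- exact: (rk_trans rk).
- move=> x Xx A Apx [y0 Ay0].
  have [|a [y Ay Ly] amin] := ord_min hK (A := [set a | exists2 y, A y & L a y]).
    by have [/(rk_nodes rk)[a La] _] := Apx _ Ay0; exists a, y0.
  exists y => // z Az; have [/(rk_nodes rk)[b Lz] zx] := Apx z Az.
  have [Xy yx] := Apx y Ay.
  have := amin b (ex_intro2 _ _ z Az Lz); rewrite le_eqVlt => /predU1P[ab|ab].
    by left; rewrite ab in Ly; exact: (rk_uniq rk Xx Lz Ly).
  by right; exact: ranked_preds_lt Ly Lz ab Xx yx zx.
Qed.

(** The rank itself is the order isomorphism from the predecessors of a node onto an initial
    segment; [height_inj] gives the other inclusion. *)
Lemma ranked_level a : level X lt a = L a.
Proof.
have [|r hr] := choice (P := fun x a => X x -> L a x).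
  move=> x; have [/(rk_nodes rk)[b Lx]|nX] := pselect (X x); first by exists b.
  by exists a => /nX.
have Lh b x : L b x -> height X lt x b.
  move=> Lx; have Xx := LX Lx; exists r.
    split => [y [Xy yx]|y z /set_mem[Xy yx] /set_mem[Xz zx] yz|c cb].
    - exact: (rk_lt rk (hr _ Xy) Lx).
    - by apply: (rk_uniq rk Xx (hr _ Xy)) => //; rewrite yz; exact: hr.
    - have [y Ly yx] := rk_pred rk Lx cb; have Xy := LX Ly.
      by exists y => //; exact: (rk_inj rk (hr _ Xy) Ly).
  move=> y z [Xy yx] [Xz zx]; split; first exact: (rk_lt rk (hr _ Xy) (hr _ Xz)).
  by move=> yz; exact: (ranked_preds_lt (hr _ Xy) (hr _ Xz) yz Xx).
apply/seteqP; split => x; last by move=> Lx; split; [exact: LX Lx|exact: Lh].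
move=> [Xx hx]; have /(rk_nodes rk)[b Lx] := Xx.
by rewrite (height_inj hK hx (Lh _ _ Lx)).
Qed.

Lemma ranked_restrict_levels : restrict_levels X lt [set: K] = X.
Proof.
apply/seteqP; split => x; first by case=> a _; rewrite ranked_level => /LX.
by move=> /(rk_nodes rk)[a La]; exists a => //; rewrite ranked_level.
Qed.

Lemma ranked_knormal :
  (forall a, (forall b, a <= b) -> exists r, L a = [set r]) ->
  (forall a, ~ ([set: K] #<= L a)) ->
  (forall a b s, is_succ a b -> L a s ->
     exists t1 t2, [/\ L b t1, L b t2, lt s t1, lt s t2 & t1 <> t2]) ->
  (forall a b s, a < b -> L a s -> exists2 t, L b t & lt s t) ->
  (forall a s t, is_limit a -> L a s -> L a t ->
     preds X lt s = preds X lt t -> s = t) ->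
  knormal K X lt.
Proof.
move=> root small split ext lim; split.
- exact: ranked_tree.
- move=> x /(rk_nodes rk)[a]; rewrite -ranked_level => -[_ hx]; by exists a.
- have [o omin] := ord_bot hK; have [r Lo] := root o omin.
  have Lr : L o r by rewrite Lo.
  exists r; split.
    split; first exact: LX Lr.
    rewrite -subset0 => x [/(rk_nodes rk)[a Lx]] /(rk_lt rk Lx Lr).
    by rewrite ltNge omin.
  move=> x [/(rk_nodes rk)[a Lx] px0].
  have := omin a; rewrite le_eqVlt => /predU1P[oa|oa].
    by move: Lx; rewrite -oa Lo => ->.
  have [y Ly yx] := rk_pred rk Lx oa.
  have : preds X lt x y by split => //; exact: LX Ly.
  by rewrite px0.
- by move=> a; rewrite ranked_level; exact: small.
- move=> s /(rk_nodes rk)[a Ls] _; have [b sb] := ord_succ hK a.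
  have [t1 [t2 [Lt1 Lt2 st1 st2 t12]]] := split a b s sb Ls.
  have imm t : L b t -> lt s t -> imm_succ X lt s t.
    move=> Lt st; split => //; first exact: LX Lt.
    move=> [z [/(rk_nodes rk)[c Lz] /(rk_lt rk Ls Lz) ac /(rk_lt rk Lz Lt)]].
    by rewrite (succ_lt _ sb) leNgt ac.
  by exists t1, t2; split => //; exact: imm.
- by move=> a b s ab; rewrite !ranked_level => Ls _; exact: ext ab Ls.
- by move=> a s t la; rewrite ranked_level; exact: lim.
Qed.

End RankedTrees.

(** * The union of the levels is a Souslinization *)

Section NewTree.
Context {dK : Order.disp_t} {K : orderType dK}.
Hypothesis hK : regular_uncountable_cardinal K.
Context {dB : Order.disp_t} {B : ctbDistrLatticeType dB}.
Hypothesis compl : complete_algebra B.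
Hypothesis cc : chain_condition K B.
Hypothesis top0 : (\top : B) != \bot.
Context (W : K -> set B).
Hypothesis hW : forall a, max_antichain (W a).
Hypothesis W_dense : forall x : B, x != \bot -> exists a w, W a w /\ w <= x.
Context (F : K -> @level_data _ B).
Hypothesis stepF : forall a, step W a F (F a).
Implicit Types (a b c : K) (s t u v x y z : B).

Local Notation P a := (nodes (F a)).
Local Notation lt := (@above _ B).

Definition new_tree : set B := [set x | exists a, P a x].
Local Notation X := new_tree.

Let ma a : max_antichain (P a). Proof. exact: step_ma (stepF a). Qed.

Let P0 a s : P a s -> s != \bot. Proof. exact: ma_neq0. Qed.

Lemma P_refines a b : b <= a -> refines (P a) (P b).
Proof.
rewrite le_eqVlt => /predU1P[->|ba]; last exact: step_refines (stepF a) _ ba.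
by move=> s; exists s.
Qed.

Lemma P_compat a b s t z : a <= b -> P a s -> P b t -> z != \bot -> z <= s ->
  z <= t -> t <= s.
Proof.
move=> ab Ps Pt z0 zs zt; have [p Pp tp] := P_refines ab Pt.
by rewrite (ma_eq (ma a) z0 Ps Pp zs (le_trans zt tp)).
Qed.

(** A node [s] kept from level [a] to level [b] would lie inside one node of the level after [a],
    whereas splitting puts two nodes of that level below [s]. *)
Lemma P_strict a b s t : a < b -> P a s -> P b t -> t <= s -> t < s.
Proof.
move=> ab Ps Pt ts; rewrite lt_neqAle ts andbT; apply/eqP => tE; subst t.
have [c sc] := ord_succ hK a; have cb : c <= b by case: sc => _; apply.
have [u [v [[Pu Pv] uv [us vs] _]]] := step_split (stepF c) sc Ps true.
have [p Pp sp] := P_refines cb Pt; apply: uv.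
rewrite (ma_eq (ma c) (P0 Pu) Pu Pp (lexx _) (le_trans us sp)).
by rewrite (ma_eq (ma c) (P0 Pv) Pv Pp (lexx _) (le_trans vs sp)).
Qed.

Lemma P_ext a b s : a <= b -> P a s -> exists2 t, P b t & t <= s.
Proof.
move=> ab Ps; have [z [t [z0 Pt zs zt]]] := ma_meet (ma b) (P0 Ps).
by exists t => //; exact: P_compat ab Ps Pt z0 zs zt.
Qed.

Lemma P_lt a b s t : P a s -> P b t -> t < s -> a < b.
Proof.
move=> Ps Pt ts; rewrite ltNge; apply/negP => ba.
have := P_compat ba Pt Ps (P0 Pt) (lexx _) (ltW ts); by rewrite lt_geF.
Qed.

Lemma new_tree_ranked : ranked X lt (fun a => P a).
Proof.
split => //.
- move=> a b x Pa Pb; case: (ltgtP a b) => [ab|ba|//].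
  + by have := P_strict ab Pa Pb (lexx _); rewrite ltxx.
  + by have := P_strict ba Pb Pa (lexx _); rewrite ltxx.
- by move=> x y z _ _ _ xy yz; exact: lt_trans yz xy.
- by move=> a b x y; exact: P_lt.
- move=> a b y Py ab; have [x Px yx] := P_refines (ltW ab) Py.
  by exists x => //; exact: P_strict ab Px Py yx.
- move=> a x x' y [b Py] Px Px' yx yx'.
  by apply: (ma_eq (ma a) (P0 Py)) => //; exact: ltW.
Qed.

Lemma P_bottom a : (forall b, a <= b) -> P a = [set \top].
Proof.
move=> a0; have ns b : ~ is_succ b a by case; rewrite ltNge a0.
have Pt s : P a s -> s = \top.
  move=> Ps; have [_ h] := step_limit (stepF a) ns Ps.
  by apply/eqP; rewrite eq_le lex1 h// => c; rewrite ltNge a0.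
have [_ [p [_ Pp _ _]]] := ma_meet (ma a) top0.
by apply/seteqP; split => [s /Pt//|_ ->]; rewrite -(Pt p).
Qed.

Lemma P_limit a s t : is_limit a -> P a s -> (forall p, preds X lt s p -> t <= p) ->
  t <= s.
Proof.
move=> la Ps tp; have [_ h] := step_limit (stepF a) (fun b => @limit_not_succ _ _ _ b la) Ps.
apply: h => c ca; have [p Pp sp] := P_refines (ltW ca) Ps; exists p; split => //.
by apply: tp; split; [exists c|exact: P_strict ca Pp Ps sp].
Qed.

Lemma new_tree_knormal : knormal K X lt.
Proof.
apply: (ranked_knormal hK new_tree_ranked).
- by move=> a /P_bottom ->; exists \top.
- by move=> a; exact: ma_small.
- move=> a b s sb Ps; have ab : a < b by case: sb.
  have [u [v [[Pu Pv] uv [us vs] _]]] := step_split (stepF b) sb Ps true.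
  by exists u, v; split => //; [exact: P_strict Ps Pu us|exact: P_strict Ps Pv vs].
- move=> a b s ab Ps; have [t Pt ts] := P_ext (ltW ab) Ps.
  by exists t => //; exact: P_strict ab Ps Pt ts.
- move=> a s t la Ps Pt st; apply/eqP; rewrite eq_le.
  rewrite (P_limit la Ps) ?(P_limit la Pt)// => p; first by rewrite -st => -[_ /ltW].
  by rewrite st => -[_ /ltW].
Qed.

(** A chain of size kappa has nodes beyond every rank and yields a decreasing node [x a] on each
    level. The differences of successive [x a] are kappa many disjoint nonzero elements, against the
    chain condition. *)
Lemma new_tree_chain A : tree_chain X lt A -> ~ ([set: K] #<= A).
Proof.
move=> [AX Ac] /(card_le_funE (\bot : B))[f fA fi].
have far a : exists x, A x /\ exists2 b, a < b & P b x.
  (* Otherwise the rank, injective on a chain, would embed [K] into [below c]. *)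
  apply: contrapT => /forallNP nA; have [c [ac sc]] := ord_succ hK a.
  have [r hr] := choice (fun d => AX _ (fA d I)).
  apply: (ruc_cardinal hK (a := c)); apply: (card_le_fun (f := r)) => [d _|d d' dI d'I rdd'].
    rewrite /below /= (succ_lt _ (conj ac sc)) leNgt; apply/negP => ad.
    by apply: (nA (f d)); split; [exact: fA|exists (r d)].
  apply: fi => //; case: (Ac _ _ (fA d I) (fA d' I)) => // /(P_lt (hr _)) h.
  - by have := h _ (hr d'); rewrite rdd' ltxx.
  - by have := h _ (hr d); rewrite rdd' ltxx.
have [g hg] := choice far.
have [|x hx] := choice (P := fun a s => P a s /\ g a <= s).
  move=> a; have [_ [b ab Pg]] := hg a.
  by have [s Ps gs] := P_refines (ltW ab) Pg; exists s.
have g0 a : g a != \bot by have [_ [b _ /P0]] := hg a.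
have x_anti a b : a <= b -> x b <= x a.
  move=> ab; have [[Pxa gxa] [Pxb gxb]] := (hx a, hx b).
  have [z [z0 za zb]] : exists z, [/\ z != \bot, z <= g a & z <= g b].
    have [[Aa _] [Ab _]] := (hg a, hg b).
    by case: (Ac _ _ Aa Ab) => [gE|/ltW ?|/ltW ?]; [exists (g a); rewrite -gE|exists (g b)|exists (g a)].
  exact: (P_compat ab Pxa Pxb z0 (le_trans za gxa) (le_trans zb gxb)).
have [sc hsc] := choice (ord_succ hK).
pose y a := (x a `&` ~` (x (sc a)))%O.
have y0 a : y a != \bot.
  rewrite disj_leC complK; apply/negP => xsx; have [asc _] := hsc a.
  have := P_strict asc (proj1 (hx a)) (proj1 (hx (sc a))) (x_anti _ _ (ltW asc)).
  by move=> /lt_geF; rewrite xsx.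
have ydisj a b : a < b -> (y a `&` y b)%O = \bot.
  move=> ab; apply/eqP; rewrite -lex0 -(meetCx (x (sc a))) lexI.
  rewrite (le_trans (leIl _ _) (leIr _ _))/= (le_trans (leIr _ _))//.
  by rewrite (le_trans (leIl _ _))// x_anti//; case: (hsc a) => _; apply.
apply: (cc (A := range y)) => [_ [a _ <-]|_ _ [a _ <-] [b _ <-]|].
- exact/eqP.
- case: (ltgtP a b) => [/ydisj//|/ydisj + _|-> //]; by rewrite meetC.
- apply: (card_le_fun (f := y)) => [a _|a b _ _ yab]; first by exists a.
  case: (ltgtP a b) => // /ydisj; rewrite yab meetxx => yb0.
  + by have := y0 b; rewrite yb0 eqxx.
  + by have := y0 b; rewrite yb0 eqxx.
Qed.

Lemma new_tree_antichain A : tree_antichain X lt A -> ~ ([set: K] #<= A).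
Proof.
move=> [AX Ac]; apply: cc => [x /AX[a /P0/eqP]//|x y Ax Ay xy].
have [[a Px] [b Py]] := (AX _ Ax, AX _ Ay).
apply/eqP; apply: contrapT => /negP z0; apply: xy.
have [ab|ba] := leP a b.
  have := P_compat ab Px Py z0 (leIl _ _) (leIr _ _).
  by rewrite le_eqVlt => /predU1P[//|/(Ac _ _ Ax Ay)].
have := P_compat (ltW ba) Py Px z0 (leIr _ _) (leIl _ _).
by rewrite le_eqVlt => /predU1P[//|/(Ac _ _ Ay Ax)].
Qed.

Lemma new_tree_souslinization : souslinization K X.
Proof.
split.
- by move=> [a /P0]; rewrite eqxx.
(* Level [b] refines [W a], so a new node meeting [w] lies below [w]. *)
- move=> x /eqP/W_dense[a [w [Ww wx]]]; have [b sb] := ord_succ hK a.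
  have [z [t [z0 Pt zw zt]]] := ma_meet (ma b) (ma_neq0 (hW a) Ww).
  have [w' Ww' tw] := step_dense (stepF b) sb Pt.
  exists t; first by exists b.
  by apply: le_trans wx; rewrite (ma_eq (hW a) z0 Ww Ww' zw (le_trans zt tw)).
- split.
  + exact: new_tree_knormal.
  + move=> a; rewrite (ranked_level hK new_tree_ranked).
    by have [_ [p [_ Pp _ _]]] := ma_meet (ma a) top0; exists p.
  + exact: new_tree_chain.
  + exact: new_tree_antichain.
- move=> t a la; rewrite (ranked_level hK new_tree_ranked) => Pt.
  apply/eqP; rewrite eq_le; apply/andP; split.
    by apply/(bprod_glb compl) => p [_ /ltW].
  by apply: (P_limit la Pt) => p; exact: bprod_le.
Qed.

End NewTree.

(** * The equivalence by bits, its quotient tree and niceness *)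

Section NewTER.
Context {dK : Order.disp_t} {K : orderType dK}.
Hypothesis hK : regular_uncountable_cardinal K.
Context {dB : Order.disp_t} {B : ctbDistrLatticeType dB}.
Hypothesis cc : chain_condition K B.
Hypothesis top0 : (\top : B) != \bot.
Context (W : K -> set B) (F : K -> @level_data _ B).
Hypothesis stepF : forall a, step W a F (F a).
Implicit Types (a b c d : K) (r s t u v x y z : B).

Local Notation P a := (nodes (F a)).
Local Notation lt := (@above _ B).
Local Notation X := (new_tree F).

Let ma a : max_antichain (P a). Proof. exact: step_ma (stepF a). Qed.
Let ri a s : P a s -> rel_iso s (iso (F a) s). Proof. exact: step_iso (stepF a) s. Qed.
Let P0 a s : P a s -> s != \bot. Proof. exact: ma_neq0. Qed.
Let rkX : ranked X lt (fun a => P a). Proof. exact: new_tree_ranked stepF. Qed.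
Let levelX a : level X lt a = P a. Proof. by rewrite (ranked_level hK rkX). Qed.

Definition same_bits a s t : Prop := forall c s' t', c <= a -> P c s' -> P c t' ->
  s <= s' -> t <= t' -> bit (F c) s' = bit (F c) t'.

Definition bit_equiv s t : Prop := exists a, [/\ P a s, P a t & same_bits a s t].
Local Notation R := bit_equiv.

Let P_eq a s t u : P a s -> P a t -> u != \bot -> u <= s -> u <= t -> s = t.
Proof. by move=> Ps Pt u0; exact: (ma_eq (ma a)). Qed.

Lemma bit_equiv_refl s : X s -> R s s.
Proof.
move=> [a Ps]; exists a; split => // c s' t' _ Ps' Pt' ss' st'.
by rewrite (P_eq Ps' Pt' (P0 Ps) ss' st').
Qed.

Lemma bit_equiv_sym s t : R s t -> R t s.
Proof.
move=> [a [Ps Pt st]]; exists a; split => // c t' s' ca Pt' Ps' tt' ss'.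
by apply/esym; exact: st.
Qed.

Lemma bit_equiv_level a s t : P a s -> R s t -> P a t.
Proof. by move=> Ps [b [Ps' Pt _]]; rewrite (rk_inj rkX Ps Ps'). Qed.

Lemma bit_equivE a s t : P a s -> R s t -> same_bits a s t.
Proof. by move=> Ps [b [Ps' Pt st]]; rewrite (rk_inj rkX Ps Ps'). Qed.

Lemma bit_equiv_trans s t u : R s t -> R t u -> R s u.
Proof.
move=> [a [Ps Pt st]] [b [Pt' Pu tu]]; have ab := rk_inj rkX Pt Pt'; subst b.
exists a; split => // c s' u' ca Ps' Pu' ss' uu'.
have [t' Pt'' tt'] := P_refines stepF ca Pt.
by rewrite (st c s' t') // (tu c t' u').
Qed.

Lemma bit_equiv_restr a b s t s' t' : b <= a -> P a s -> R s t -> P b s' ->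
  P b t' -> s <= s' -> t <= t' -> R s' t'.
Proof.
move=> ba Ps st Ps' Pt' ss' tt'; exists b; split => // c s1 t1 cb Ps1 Pt1 ss1 tt1.
apply: (bit_equivE Ps st) => //; first exact: le_trans ba.
  exact: le_trans ss1.
exact: le_trans tt1.
Qed.

(* Bits strictly above level [a] are transported by the isomorphism between the
   two equivalent nodes, by coherence. *)
Lemma bit_equiv_lift a b s t u : a <= b -> P a s -> R s t -> P b u -> u <= s ->
  exists2 v, R u v & v <= t.
Proof.
move=> ab Ps st Pu us; have Pt := bit_equiv_level Ps st.
move: ab; rewrite le_eqVlt => /predU1P[ab|ab].
  by subst b; exists t => //; rewrite (P_eq Pu Ps (P0 Pu) (lexx _) us).
have [x ux] := ri_surj (ri Ps) us; have u0 := P0 Pu.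
rewrite -ux in Pu u0; have [Pv _ _] := step_coherent (stepF b) ab Ps Pt Pu.
exists (iso (F a) t x); last exact: ri_sub (ri Pt) _.
exists b; rewrite -ux; split => // c s' t' cb Ps' Pt' us' vt'.
have [ca|ac] := leP c a.
  apply: (bit_equivE Ps st) => //.
    exact: (P_compat stepF ca Ps' Ps u0 us' (ri_sub (ri Ps) _)).
  exact: (P_compat stepF ca Pt' Pt (P0 Pv) vt' (ri_sub (ri Pt) _)).
have s's := P_compat stepF (ltW ac) Ps Ps' u0 (ri_sub (ri Ps) _) us'.
have [x' sx'] := ri_surj (ri Ps) s's; rewrite -sx' in Ps' us' *.
have [Pt1 bt1 _] := step_coherent (stepF c) ac Ps Pt Ps'.
rewrite -bt1; congr (bit _ _).
apply: (P_eq Pt1 Pt' (P0 Pv)) => //.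
by rewrite (ri_le (ri Pt)) -(ri_le (ri Ps)).
Qed.

Lemma bit_equiv_succ a c q s u v : is_succ a c -> P a q -> R q s -> P c u -> P c v ->
  u <= q -> v <= s -> bit (F c) u = bit (F c) v -> R u v.
Proof.
move=> sc Pq qs Pu Pv uq vs uv; have Ps := bit_equiv_level Pq qs.
exists c; split => // d s' t' dc Ps' Pt' us' vt'.
move: dc; rewrite le_eqVlt (succ_lt _ sc) => /predU1P[dc|da].
  subst d; rewrite -(P_eq Pu Ps' (P0 Pu) (lexx _) us').
  by rewrite -(P_eq Pv Pt' (P0 Pv) (lexx _) vt').
apply: (bit_equivE Pq qs) => //.
  exact: (P_compat stepF da Ps' Pq (P0 Pu) us' uq).
exact: (P_compat stepF da Pt' Ps (P0 Pv) vt' vs).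
Qed.

Local Notation cls := (eqclass X R).

Definition class_level a : set (set B) := [set cls s | s in P a].

Lemma eqclass_eq s t : R s t -> cls s = cls t.
Proof.
move=> st; apply/seteqP; split => u [Xu su]; split => //.
  exact: bit_equiv_trans (bit_equiv_sym st) su.
exact: bit_equiv_trans st su.
Qed.

Let inX a s : P a s -> X s. Proof. by move=> Ps; exists a. Qed.

Lemma class_level_elt a A s : class_level a A -> A s -> P a s /\ A = cls s.
Proof.
move=> [t Pt <-] [Xs ts]; split; first exact: bit_equiv_level Pt ts.
exact: eqclass_eq.
Qed.

Let self_cls a s : P a s -> cls s s.
Proof. by move=> Ps; split; [exact: inX Ps|exact/bit_equiv_refl/inX/Ps]. Qed.

(** [bit_equiv_restr] makes restriction to lower levels well defined on classes; transitivity and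
    uniqueness of predecessors follow. *)
Lemma quotient_ranked :
  ranked (quotient_nodes X R) (quotient_lt lt) class_level.
Proof.
have QL A : quotient_nodes X R A -> exists a, class_level a A.
  by move=> [s [a Ps] <-]; exists a, s.
split.
- move=> A; split; first exact: QL.
  by move=> [a [s Ps <-]]; exists s => //; exact: inX Ps.
- move=> a b A [s Ps <-] /class_level_elt/(_ (self_cls Ps))[Ps' _].
  exact: (rk_inj rkX Ps Ps').
- move=> A A' A'' /QL[a LA] /QL[b LB] /QL[c LC] [s [t [As Bt ts]]] [t1 [u [Bt1 Cu ut1]]].
  have [[Ps AE] [Pt BE]] := (class_level_elt LA As, class_level_elt LB Bt).
  have [[Pt1 BE1] [Pu _]] := (class_level_elt LB Bt1, class_level_elt LC Cu).
  have ab := P_lt stepF Ps Pt ts; have [s1 Ps1 ts1] := P_refines stepF (ltW ab) Pt1.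
  exists s1, u; split => //; last exact: lt_le_trans ut1 ts1.
  rewrite AE; split; first exact: inX Ps1.
  have [_ tt1] : cls t t1 by rewrite -BE.
  exact: (bit_equiv_restr (ltW ab) Pt tt1 Ps Ps1 (ltW ts)).
- move=> a b A A' LA LB [s [t [As Bt ts]]].
  have [[Ps _] [Pt _]] := (class_level_elt LA As, class_level_elt LB Bt).
  exact: P_lt Ps Pt ts.
- move=> a b A [t Pt <-] ab; have [s Ps st] := rk_pred rkX Pt ab.
  by exists (cls s); [exists s|exists s, t; split; [exact: self_cls Ps|exact: self_cls Pt|]].
- move=> a A A' C /QL[b LC] LA LB [s [t [As Ct ts]]] [s1 [t1 [As1 Ct1 ts1]]].
  have [[Ps AE] [Ps1 BE]] := (class_level_elt LA As, class_level_elt LB As1).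
  have [[Pt CE] [Pt1 CE1]] := (class_level_elt LC Ct, class_level_elt LC Ct1).
  have [_ tt1] : cls t t1 by rewrite -CE.
  rewrite AE BE; apply: eqclass_eq; have ab := P_lt stepF Ps Pt ts.
  exact: (bit_equiv_restr (ltW ab) Pt tt1 Ps Ps1 (ltW ts) (ltW ts1)).
Qed.

Lemma quotient_knormal : knormal K (quotient_nodes X R) (quotient_lt lt).
Proof.
apply: (ranked_knormal hK quotient_ranked).
- move=> a /(P_bottom top0 stepF) Pa; exists (cls \top).
  by rewrite /class_level Pa image_set1.
- move=> a Ka; apply: (ma_small cc (ma a)); exact: card_le_trans Ka (card_image_le _ _).
- move=> a c A sc [s Ps <-]; have ac : a < c by case: sc.
  (* Successors of [s] with different bits give different classes. *)
  have [u [_ [[Pu _] _ [us _] [bu _]]]] := step_split (stepF c) sc Ps true.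
  have [v [_ [[Pv _] _ [vs _] [bv _]]]] := step_split (stepF c) sc Ps false.
  have below_s w : P c w -> w <= s -> quotient_lt lt (cls s) (cls w).
    move=> Pw ws; exists s, w; split; [exact: self_cls Ps|exact: self_cls Pw|].
    exact: (P_strict hK stepF ac Ps Pw ws).
  exists (cls u), (cls v); split; [by exists u|by exists v|exact: below_s|exact: below_s|].
  move=> uv; have := self_cls Pv; rewrite -uv => -[_ /(bit_equivE Pu)].
  by move=> /(_ c u v (lexx _) Pu Pv (lexx _) (lexx _)); rewrite bu bv.
- move=> a b A ab [s Ps <-]; have [t Pt ts] := P_ext stepF (ltW ab) Ps.
  exists (cls t); first by exists t.
  exists s, t; split; [exact: self_cls Ps|exact: self_cls Pt|].
  exact: (P_strict hK stepF ab Ps Pt ts).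
(* Limit nodes all carry the bit [false]. A lower bit of [s] belongs to some [s'] whose class also
   precedes that of [t], so [t] has the same bit there. *)
- move=> a _ _ la [s Ps <-] [t Pt <-] st; apply: eqclass_eq; exists a; split => // c s' t'.
  rewrite le_eqVlt => /predU1P[->|ca] Ps' Pt' ss' tt'.
    have ns b := @limit_not_succ _ _ _ b la.
    have [-> _] := step_limit (stepF a) ns Ps'.
    by have [-> _] := step_limit (stepF a) ns Pt'.
  have : preds (quotient_nodes X R) (quotient_lt lt) (cls t) (cls s').
    rewrite -st; split; first by exists s' => //; exact: inX Ps'.
    exists s', s; split; [exact: self_cls Ps'|exact: self_cls Ps|].
    exact: (P_strict hK stepF ca Ps' Ps ss').
  move=> [_ [s1 [t1 [[_ ss1] [_ tt1] ts1]]]].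
  have Ps1 := bit_equiv_level Ps' ss1; have Pt1 := bit_equiv_level Pt tt1.
  apply: (bit_equivE Ps' _ (lexx c)) => //.
  apply: bit_equiv_trans ss1 _.
  exact: (bit_equiv_restr (ltW ca) Pt1 (bit_equiv_sym tt1) Ps1 Pt' (ltW ts1) tt').
Qed.

Lemma bit_equiv_nice_ext s s' t : X s -> X s' -> lt s s' -> R s t ->
  exists t', [/\ X t', lt t t' & R s' t'].
Proof.
move=> [a Ps] [b Ps'] s's st; have ab := P_lt stepF Ps Ps' s's.
have [t' st' t't] := bit_equiv_lift (ltW ab) Ps st Ps' (ltW s's).
have Pt' := bit_equiv_level Ps' st'; exists t'; split => //; first exact: inX Pt'.
exact: (P_strict hK stepF ab (bit_equiv_level Ps st) Pt' t't).
Qed.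

Lemma bit_equiv_ter : is_ter K X lt R.
Proof.
split.
- exact: (new_tree_knormal hK cc top0 stepF).
- exact: bit_equiv_refl.
- by move=> s t _ _; exact: bit_equiv_sym.
- by move=> s t u _ _ _; exact: bit_equiv_trans.
- by move=> s t a _ st; rewrite levelX => Ps; exact: bit_equiv_level Ps st.
- move=> s s' t t' a; rewrite levelX => Ps Pt [b Ps'] Xt' ss' tt' st'.
  apply: (bit_equiv_restr _ Ps' st' Ps Pt (ltW ss') (ltW tt')).
  exact: ltW (P_lt stepF Ps Ps' ss').
- exact: quotient_knormal.
(* Niceness always provides an equivalent extension, which refutes the premise of this condition. *)
- move=> s t s' u c c'; rewrite levelX => Ps Pt st Xs' ss' nt'.
  by case: nt'; exact: (bit_equiv_nice_ext (inX Ps)).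
Qed.

(** Splitting gives two nodes just below [r] with the bit of [s1], the node over [s] one level above
    [a]. Both are equivalent to [s1], so [s] has an equivalent copy below each. *)
Lemma bit_equiv_card a b s q r : a < b -> P b s -> P a q -> s <= q -> R r q ->
  exists t1 t2, [/\ t1 <> t2, R s t1 /\ R s t2 & t1 < r /\ t2 < r].
Proof.
move=> ab Ps Pq sq /bit_equiv_sym qr; have Pr := bit_equiv_level Pq qr.
have [c sc] := ord_succ hK a; have cb : c <= b by case: sc => _; apply.
have ac : a < c by case: sc.
have [s1 Ps1 ss1] := P_refines stepF cb Ps.
have s1q := P_compat stepF (ltW ac) Pq Ps1 (P0 Ps) sq ss1.
have [u [v [[Pu Pv] uv [ur vr] [bu bv]]]] := step_split (stepF c) sc Pr (bit (F c) s1).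
have lift w : P c w -> w <= r -> bit (F c) w = bit (F c) s1 ->
    exists t, [/\ R s t, t <= w & t < r].
  move=> Pw wr bw.
  have s1w := bit_equiv_succ sc Pq qr Ps1 Pw s1q wr (esym bw).
  have [t st tw] := bit_equiv_lift cb Ps1 s1w Ps ss1.
  by exists t; split => //; apply: le_lt_trans tw _; exact: (P_strict hK stepF ac Pr Pw wr).
have [t1 [st1 t1u t1r]] := lift u Pu ur bu.
have [t2 [st2 t2v t2r]] := lift v Pv vr bv.
exists t1, t2; split => // t12; apply: uv.
apply: (P_eq Pu Pv (P0 (bit_equiv_level Ps st1)) t1u); by rewrite t12.
Qed.

Lemma bit_equiv_nice (M : set K) (m0 m1 : K) : M `<=` [set m0; m1] ->
  nice_ter X lt R M.
Proof.
move=> Mm; split.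
- by move=> s s' t Xs Xs' _; exact: bit_equiv_nice_ext.
- move=> a b s q r ab; rewrite /restr levelX => Ps [].
  rewrite levelX => Pq sq Xr rq.
  have {}sq : s <= q by case: sq => [->|/ltW].
  have [t1 [t2 [t12 [st1 st2] [t1r t2r]]]] := bit_equiv_card ab Ps Pq sq rq.
  have Pr := bit_equiv_level Pq (bit_equiv_sym rq).
  have in_set t : R s t -> t < r -> cls s t /\ P a r /\ (r = t \/ lt r t).
    move=> st tr; split; last by split => //; right.
    by split => //; exact: inX (bit_equiv_level Ps st).
  apply: (card_le_fun (f := fun m => if m == m0 then t1 else t2)).
    by move=> m _ /=; case: ifP => _; [exact: (in_set _ st1 t1r)|exact: (in_set _ st2 t2r)].
  move=> m m' /set_mem/Mm mM /set_mem/Mm mM'.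
  case: eqP mM => [-> _|_ [//|->]]; case: eqP mM' => [-> _|_ [//|->]] //.
  by move=> /esym/t12.
Qed.

End NewTER.

(** * Assembly of the subalgebra *)

Lemma smallest_complete_subalgebra dB (B : ctbDistrLatticeType dB) (A : set B) :
  complete_subalgebra (smallest (@complete_subalgebra _ B) A).
Proof.
split=> [x Ax C|S SA C|S SA C] [cC AC].
- by apply: (csa_compl cC); apply: Ax.
- by apply: (csa_sum cC) => x /SA; apply.
- by apply: (csa_prod cC) => x /SA; apply.
Qed.

Theorem theorem4p7 (dK : Order.disp_t) (K : orderType dK)
    (hK : regular_uncountable_cardinal K)
    (dB : Order.disp_t) (B : ctbDistrLatticeType dB)
    (hB : souslin_algebra K B) (hom : homogeneous B) :
  exists A : set B, complete_subalgebra A /\ infty_nice K A.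
Proof.
have [compl cc distr [T sT]] := hB.
have [o omin] := ord_bot hK.
have top0 : (\top : B) != \bot.
  have [t [Tt _]] := st_height (sz_tree sT) o.
  apply/eqP => tb; apply: (sz_nonzero sT).
  by have -> : \bot = t by apply/eqP; rewrite eq_le le0x -tb lex1.
have [G hG] := homogeneous_ri hom.
have [e [S [mS halves]]] := two_halves (souslinization_atomless hK sT) top0.
have [F stepF] := levels_exist hK compl distr cc top0 hG
  (fun a => souslinization_levels hK a sT) mS halves.
have W_dense (x : B) : x != \bot -> exists (a : K) w, level T (@above _ B) a w /\ w <= x.
  move=> /eqP/(sz_dense sT)[t Tt tx].
  by have [a ha] := kn_height (st_normal (sz_tree sT)) Tt; exists a, t.
have sX := new_tree_souslinization hK compl cc top0
  (fun a => souslinization_levels hK a sT) W_dense stepF.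
(* [m2] is the ordinal 2 and serves as the cardinal mu. *)
have [m1 s1] := ord_succ hK o; have [m2 s2] := ord_succ hK m1.
have [[om1 _] [m12 _]] := (s1, s2).
have XE := ranked_restrict_levels hK (new_tree_ranked hK stepF).
set X := new_tree F in sX XE *; set R := bit_equiv F.
(* Used twice: 2 is a cardinal, and it exceeds 1. *)
have one (D : set K) (U : Type) (E : set U) : D o -> D m1 -> 
    (forall x y, E x -> E y -> x = y) -> forall x0 : U, ~ (D #<= E).
  move=> Do Dm E1 x0 /(card_le_funE x0)[f ff fi].
  have /(fi _ _ (mem_set Do) (mem_set Dm)) om := E1 _ _ (ff o Do) (ff m1 Dm).
  by rewrite om ltxx in om1.
exists (smallest (@complete_subalgebra _ B) [set bsum (eqclass X R s) | s in X]).
split; first exact: smallest_complete_subalgebra.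
exists X; split => //; exists m2; split.
- move=> b; rewrite (succ_lt _ s2) => bm; apply: (one _ _ _ _ _ _ o) => //.
  + exact: lt_trans om1 m12.
  + move=> x y /lt_le_trans/(_ bm) + /lt_le_trans/(_ bm).
    rewrite !(succ_lt _ s1) => xo yo.
    by apply/eqP; rewrite eq_le (le_trans xo (omin _)) (le_trans yo (omin _)).
- apply: (one _ _ _ _ _ _ tt) => //; last by move=> [] [].
  exact: lt_trans om1 m12.
(* All levels are kept, so the club is the whole of [K]. *)
exists [set: K]; split; first by split=> // a; exists a.
exists R; rewrite XE; split => //.
- exact: bit_equiv_ter stepF.
- apply: (bit_equiv_nice hK stepF (m0 := o) (m1 := m1)) => m; rewrite /below /=.
  rewrite (succ_lt _ s2) le_eqVlt (succ_lt _ s1) => /predU1P[->|mo]; first by right.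
  by left; apply/eqP; rewrite eq_le mo omin.
Qed.
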